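(* Let $p\ge 1$ be an integer, let $\mathcal{X}=[0,1]^p$, and let $\mathscr{B}$ be the Borel $\sigma$-algebra of $\mathcal{X}$. Let $q:\mathcal{X}\to(0,\infty)$ be Lipschitz continuous, i.e., there is a constant $L>0$ such that $|q(u)-q(v)|\le L\,d(u,v)$ for all $u,v\in\mathcal{X}$, where $d$ is the Euclidean distance. For $s\in(0,\infty)$ and $n\ge 2$, let $D^*=\{x_1^*,\ldots,x_n^*\}\subset\mathcal{X}$ be an $n$-point minimum energy design for $q$ and $s$ (as defined in the context) having the smallest index among all such $n$-point minimum energy designs, and define the probability measure $\mathcal{P}_n$ on $(\mathcal{X},\mathscr{B})$ by $$\mathcal{P}_n(A)=\frac{\mathrm{card}\{x_i^*: 1\le i\le n,\ x_i^*\in A\}}{n},\qquad A\in\mathscr{B}.$$ Then there exists a probability measure $\mathcal{P}$ on $(\mathcal{X},\mathscr{B})$ such that, for every fixed $s\in(0,\infty)$, $\mathcal{P}_n$ converges weakly to $\mathcal{P}$ as $n\to\infty$. Moreover, $\mathcal{P}$ has a density (with respect to Lebesgue measure) proportional to $1/q^{2p}(x)$ over $\mathcal{X}$.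
   Context: For $s>0$ and $u,v\in\mathbb{R}^p$ define the generalized distance $$d_s(u,v)=\left(\frac1p\sum_{l=1}^p|u_l-v_l|^s\right)^{1/s}$$ (this is not a metric when $s<1$). The function $q$ is called the charge function; it corresponds to the (unnormalized) target density $f$ via $q=1/f^{1/(2p)}$, i.e., $f=1/q^{2p}$. An $n$-point minimum energy design for $q$ and $s$ is a set of $n$ points $D=\{x_1,\ldots,x_n\}\subset\mathcal{X}$ that maximizes, over all $n$-point designs in $\mathcal{X}$, $$\psi(D)=\min_{i\ne j} f^{1/(2p)}(x_i)\,f^{1/(2p)}(x_j)\,d_s(x_i,x_j)=\min_{i\neq j}\frac{d_s(x_i,x_j)}{q(x_i)q(x_j)},$$ or equivalently minimizes $\max_{i\ne j} q(x_i)q(x_j)/d_s(x_i,x_j)$. The index of a minimum energy design $D$ is the number of unordered pairs $\{i,j\}$, $i\ne j$, at which the minimum defining $\psi(D)$ is attained. *)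

(* Defs.v *)
From HB Require Import structures.
From mathcomp Require Import all_boot all_order all_algebra finmap.
From mathcomp Require Import all_classical all_reals all_analysis.
Set Implicit Arguments.
Unset Strict Implicit.
Unset Printing Implicit Defensive.
Import Order.TTheory GRing.Theory Num.Theory.
Import numFieldNormedType.Exports.
Local Open Scope classical_set_scope.
Local Open Scope ring_scope.

Definition unit_cube (R : realType) (p : nat) : set 'rV[R]_p :=
  [set x | forall i, x ord0 i \in `[0, 1]].
Arguments unit_cube : clear implicits.

Lemma unit_cube0 (R : realType) (p : nat) : (0 : 'rV[R]_p) \in unit_cube R p.
Proof. by apply/mem_set => i; rewrite mxE in_itv/= lexx ler01. Qed.

Definition cube (R : realType) (p : nat) : Type := set_type (unit_cube R p).
HB.instance Definition _ (R : realType) (p : nat) := Choice.on (cube R p).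
HB.instance Definition _ (R : realType) (p : nat) := Topological.on (cube R p).
HB.instance Definition _ (R : realType) (p : nat) :=
  isPointed.Build (cube R p) (exist _ 0 (unit_cube0 R p)).

Definition coord (R : realType) (p : nat) (x : cube R p) (i : 'I_p) : R :=
  sval x ord0 i.

Definition borel (T : ptopologicalType) := g_sigma_algebraType (@open T).
HB.instance Definition _ (T : ptopologicalType) := Measurable.on (borel T).

Lemma sigma_finite_product d1 d2 (T1 : measurableType d1)
    (T2 : measurableType d2) (R : realType)
    (m1 : {sigma_finite_measure set T1 -> \bar R})
    (m2 : {sigma_finite_measure set T2 -> \bar R}) :
  sigma_finite setT (m1 \x m2)%E.
Proof.
have /sigma_finiteP[F [TF ndF Foo]] := sigma_finiteT m1.
have /sigma_finiteP[G [TG ndG Goo]] := sigma_finiteT m2.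
exists (fun n => F n `*` G n).
  rewrite -setXTT TF TG predeqE => -[x y]; split.
    move=> [/= [n _ Fnx] [k _ Gky]]; exists (maxn n k) => //; split.
    - by move: x Fnx; exact/subsetPset/ndF/leq_maxl.
    - by move: y Gky; exact/subsetPset/ndG/leq_maxr.
  by move=> [n _ []/= ? ?]; split; exists n.
move=> k; have [? ?] := Foo k; have [? ?] := Goo k.
split; first exact: measurableX.
by rewrite product_measure1E// lte_mul_pinfty// ge0_fin_numE.
Qed.

Section power_measure.
Context d (T : measurableType d) (R : realType).
Variable nu : {sigma_finite_measure set T -> \bar R}.

Section step.
Variables (n : nat) (mu : {sigma_finite_measure set (n.-tuple T) -> \bar R}).

Definition cons_pair (xt : T * n.-tuple T) : n.+1.-tuple T :=
  [tuple of xt.1 :: xt.2].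

Let m_cons A : measurable A -> measurable (cons_pair @^-1` A).
Proof.
by move=> mA; rewrite -[X in measurable X]setTI; exact: measurable_cons mA.
Qed.

Definition power_step : set (n.+1.-tuple T) -> \bar R :=
  pushforward (nu \x mu)%E cons_pair.

Let step0 : power_step set0 = 0%E.
Proof. by rewrite /power_step /pushforward preimage_set0 measure0. Qed.

Let step_ge0 A : (0 <= power_step A)%E.
Proof. by rewrite /power_step /pushforward measure_ge0. Qed.

Let step_additive : semi_sigma_additive power_step.
Proof.
move=> F mF tF mUF; rewrite /power_step /pushforward preimage_bigcup.
apply: measure_semi_sigma_additive.
- by move=> k; exact: m_cons.
- apply/trivIsetP => i j _ _ ij; rewrite -preimage_setI.
  by move/trivIsetP : tF => /(_ _ _ I I ij) ->; rewrite preimage_set0.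
- by rewrite -preimage_bigcup; exact: m_cons.
Qed.

HB.instance Definition _ :=
  isMeasure.Build _ _ _ power_step step0 step_ge0 step_additive.

Let step_sigma_finite : sigma_finite setT power_step.
Proof.
have [F TF Foo] := sigma_finite_product nu mu.
pose u (t : n.+1.-tuple T) : T * n.-tuple T := (thead t, [tuple of behead t]).
have mu_ : measurable_fun setT u.
  apply/measurable_fun_pair; first exact: measurable_tnth.
  exact: measurable_behead.
exists (fun k => u @^-1` F k).
  by rewrite -preimage_bigcup -TF preimage_setT.
move=> k; have [mFk Fk] := Foo k; split.
  by rewrite -[X in measurable X]setTI; exact: mu_.
rewrite /power_step /pushforward -comp_preimage.
rewrite (_ : u \o cons_pair = id) //.
by apply/funext => -[x t]; congr pair; exact/val_inj.
Qed.

HB.instance Definition _ := Measure_isSigmaFinite.Build _ _ _ power_step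
  step_sigma_finite.

End step.

Fixpoint power_measure (n : nat) :
    {sigma_finite_measure set (n.-tuple T) -> \bar R} :=
  if n is n'.+1 then power_step (power_measure n') else \d_[tuple].

Lemma power_measure_box (n : nat) (A : 'I_n -> set T) :
  (forall i, measurable (A i)) ->
  power_measure n [set t | forall i, A i (tnth t i)] =
  (\prod_(i < n) nu (A i))%E.
Proof.
elim: n A => [|n IH] A mA /=.
  by rewrite big_ord0 diracE mem_set// => -[].
rewrite big_ord_recl -IH//= /power_step /pushforward.
rewrite -product_measure1E//; last first.
  rewrite (_ : [set t | _] = \bigcap_(i in [set: 'I_n])
      ((@tnth n T ^~ i) @^-1` A (lift ord0 i))).
    apply: fin_bigcap_measurable => // i _.
    by rewrite -[X in measurable X]setTI; exact: measurable_tnth.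
  by apply/seteqP; split=> t h i => [_|]; exact: h.
congr (_ _).
apply/seteqP; split=> -[x t]/=.
  by move=> h; split=> [|i];
    [have := h ord0|have := h (lift ord0 i); rewrite tnthS].
move=> [h0 hS] i; case: (unliftP ord0 i) => [j ->|->//].
by rewrite tnthS.
Qed.

End power_measure.

Section lebesgue_cube.
Context (R : realType) (p : nat).
Local Notation mR := (measurableTypeR R).

Definition coords (x : cube R p) : p.-tuple mR := [tuple coord x i | i < p].

(** [p]-dimensional Lebesgue measure restricted to the unit cube. *)
Definition lebesgue_cube (A : set (borel (cube R p))) : \bar R :=
  power_measure lebesgue_measure p (coords @` A).

Lemma coords_inj : injective coords.
Proof.
move=> x y /(congr1 (fun t => tnth t)) xy; apply: val_inj => /=.
apply/rowP => i; move/(congr1 (fun f => f i)) : xy.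
by rewrite !tnth_mktuple.
Qed.

Let itv_box (ab : 'I_p -> interval R) : set (p.-tuple mR) :=
  [set t | forall i, tnth t i \in ab i].

Let measurable_box ab : measurable (itv_box ab).
Proof.
rewrite (_ : itv_box ab = \bigcap_(i in [set: 'I_p])
    ((@tnth p mR ^~ i) @^-1` [set` ab i])).
  apply: fin_bigcap_measurable => // i _.
  have mi : measurable ([set` ab i] : set mR) by exact: measurable_itv.
  by rewrite -[X in measurable X]setTI; exact: measurable_tnth.
by apply/seteqP; split=> t h i => [_|]; exact: h.
Qed.

Let coordsT : coords @` setT = itv_box (fun=> `[0, 1]).
Proof.
apply/seteqP; split=> [_ [x _ <-] i|t tc].
  by rewrite tnth_mktuple; exact: (set_mem (svalP x)).
have tP : (\row_i (tnth t i : R)) \in unit_cube R p.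
  by apply/mem_set => i; rewrite mxE; exact: tc.
pose x : cube R p := exist _ (\row_i (tnth t i : R)) tP.
exists x => //; apply: eq_from_tnth => i.
by rewrite tnth_mktuple /coord /= mxE.
Qed.

Lemma measurable_image_coords (A : set (borel (cube R p))) :
  measurable A -> measurable (coords @` A).
Proof.
move=> mA; apply: (mA [set B | measurable (coords @` B)]); split; first split.
- by rewrite /= image_set0.
- move=> B /= mB.
  rewrite (_ : _ @` _ = coords @` setT `\` coords @` B).
    by rewrite coordsT; exact: measurableD.
  apply/seteqP; split=> [_ [x [_ nBx] <-]|_ [[x _ <-] nBx]].
    split; first by exists x.
    by move=> [y By /coords_inj yx]; apply: nBx; rewrite -yx.
  by exists x => //; split=> // Bx; apply: nBx; exists x.
- by move=> F mF /=; rewrite image_bigcup; exact: bigcupT_measurable.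
move=> U /= [V oV VU].
pose rbox (q : p.-tuple (rat * rat)) := itv_box
  (fun i => `]ratr (tnth q i).1, ratr (tnth q i).2[).
pose good (q : p.-tuple (rat * rat)) :=
  rbox q `<=` [set t | V (\row_i (tnth t i : R))].
suff -> : coords @` U = coords @` setT `&` \bigcup_(q in good) rbox q.
  apply: measurableI; first by rewrite coordsT.
  rewrite bigcup_mkcond; apply: countable_bigcupT_measurable => // q.
  by case: ifP => // _; exact: measurable_box.
have rowE (x : cube R p) : \row_i (tnth (coords x) i : R) = sval x.
  by apply/rowP => i; rewrite mxE tnth_mktuple.
apply/seteqP; split=> [_ [x Ux <-]|_ [[x _ <-] [q gq xq]]]; last first.
  exists x => //; rewrite -VU; have := gq _ xq; rewrite /= rowE.
  by [].
split; first by exists x.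
move: Ux; rewrite -VU /= set_valE => Vx.
have : nbhs (sval x) V by apply: open_nbhs_nbhs.
move=> /nbhs_ballP[e /= e0 xeV].
have ab i : {ab : rat * rat | coord x i - e < ratr ab.1 < coord x i /\
    coord x i < ratr ab.2 < coord x i + e}.
  apply: cid.
  have /rat_in_itvoo[a /[!in_itv]/= ha] : coord x i - e < coord x i.
    by rewrite ltrBlDr ltrDl.
  have /rat_in_itvoo[b /[!in_itv]/= hb] : coord x i < coord x i + e.
    by rewrite ltrDl.
  by exists (a, b).
exists [tuple sval (ab i) | i < p].
  move=> t tq; apply: xeV; split=> // i j; rewrite ord1 mxE.
  have := tq j; rewrite tnth_mktuple in_itv /=.
  have [/andP[+ _] /andP[_ +]] := svalP (ab j).
  rewrite -/(coord x j) /ball /= => h1 h2 /andP[h3 h4].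
  rewrite ltr_distlC; apply/andP; split; first exact: lt_trans h3.
  exact: lt_trans h2.
move=> i; rewrite !tnth_mktuple in_itv /=.
by have [/andP[_ ->] /andP[-> _]] := svalP (ab i).
Qed.

Let lebesgue_cube0 : lebesgue_cube set0 = 0%E.
Proof. by rewrite /lebesgue_cube image_set0 measure0. Qed.

Let lebesgue_cube_ge0 A : (0 <= lebesgue_cube A)%E.
Proof. exact: measure_ge0. Qed.

Let lebesgue_cube_additive : semi_sigma_additive lebesgue_cube.
Proof.
move=> F mF tF mUF; rewrite /lebesgue_cube image_bigcup.
apply: measure_semi_sigma_additive.
- by move=> k; exact: measurable_image_coords.
- apply/trivIsetP => i j _ _ ij; apply/seteqP; split=> // _ [[x Fx <-]].
  move=> [y Fy /coords_inj yx]; move/trivIsetP : tF => /(_ _ _ I I ij) /seteqP[].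
  by move=> /(_ x) + _; apply; split=> //; rewrite -yx.
- by rewrite -image_bigcup; exact: measurable_image_coords.
Qed.

HB.instance Definition _ := isMeasure.Build _ _ _ lebesgue_cube
  lebesgue_cube0 lebesgue_cube_ge0 lebesgue_cube_additive.

End lebesgue_cube.

Section empirical_measure.
Context d (T : measurableType d) (R : realType) (D : {fset T}).

Definition empirical (A : set T) : \bar R :=
  ((#|` [fset x in D | x \in A]%fset|)%:R / (#|` D|)%:R)%:E.

Let empiricalE A : empirical A = mscale ((#|` D|)%:R^-1)%:nng
  (msum (fun k => \d_(nth point D k)) #|` D|) A.
Proof.
transitivity (((#|` D|)%:R^-1)%:E * \sum_(x <- D) (\d_x A : \bar R))%E.
  rewrite /empirical; under eq_bigr do rewrite diracE.
  rewrite sumEFin -EFinM mulrC; congr (_ * _)%:E.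
  rewrite -natr_sum card_fset_sum1 -(big_fset_condE _ _ (fun x => x \in A)).
  by rewrite big_mkcond /=; congr _%:R; apply: eq_bigr => x _; case: (x \in A).
by congr (_ * _)%E; rewrite (big_nth point) big_mkord.
Qed.

Let empirical0 : empirical set0 = 0%E.
Proof. by rewrite empiricalE measure0. Qed.

Let empirical_ge0 A : (0 <= empirical A)%E.
Proof. by rewrite empiricalE measure_ge0. Qed.

Let empirical_additive : semi_sigma_additive empirical.
Proof.
rewrite (funext empiricalE); exact: measure_semi_sigma_additive.
Qed.

HB.instance Definition _ :=
  isMeasure.Build _ _ _ empirical empirical0 empirical_ge0 empirical_additive.

Lemma empirical_setT : (0 < #|` D|)%N -> empirical setT = 1%E.
Proof.
move=> D0; rewrite /empirical (_ : [fset x in D | x \in setT]%fset = D).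
  by rewrite divff// pnatr_eq0 -lt0n.
by apply/fsetP => x; rewrite !inE/= in_setT andbT.
Qed.

End empirical_measure.
Arguments empirical {d T} R D.

Definition weak_cvg (T : ptopologicalType) (R : realType)
    (mu : nat -> {measure set (borel T) -> \bar R})
    (nu : {measure set (borel T) -> \bar R}) : Prop :=
  forall g : T -> R, continuous g -> (exists M, forall x, `|g x| <= M) ->
    (\int[mu n]_x (g x)%:E)%E @[n --> \oo] --> (\int[nu]_x (g x)%:E)%E.

Section minimum_energy_design.
Context (R : realType) (p : nat).

Definition euclidean_dist (u v : cube R p) : R :=
  Num.sqrt (\sum_(l < p) (coord u l - coord v l) ^+ 2).

Definition gen_dist (s : R) (u v : cube R p) : R :=
  (p%:R^-1 * \sum_(l < p) `|coord u l - coord v l| `^ s) `^ s^-1.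

Variables (q : cube R p -> R) (s : R).

Definition charged_dist (x y : cube R p) : R := gen_dist s x y / (q x * q y).

(** The minimum is taken in [\bar R], with value [+oo] on designs with fewer
    than two points. *)
Definition med_criterion (D : {fset cube R p}) : \bar R :=
  \big[Order.min/+oo%E]_(x <- D) \big[Order.min/+oo%E]_(y <- D | y != x)
    (charged_dist x y)%:E.

Definition is_med (n : nat) (D : {fset cube R p}) : Prop :=
  #|` D| = n /\ forall D' : {fset cube R p}, #|` D'| = n ->
    (med_criterion D' <= med_criterion D)%E.

(** [[fset x; y]] is an unordered pair. *)
Definition med_index (D : {fset cube R p}) : nat :=
  #|` [fset [fset x; y] | x in D,
        y in D & (y != x) && ((charged_dist x y)%:E == med_criterion D)]%fset|.

Definition is_min_index_med (n : nat) (D : {fset cube R p}) : Prop :=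
  is_med n D /\ forall D' : {fset cube R p}, is_med n D' ->
    (med_index D <= med_index D')%N.

End minimum_energy_design.

(* Main.v *)
Require Import Defs.
From HB Require Import structures.
From mathcomp Require Import all_boot all_order all_algebra finmap.
From mathcomp Require Import all_classical all_reals all_analysis.
From mathcomp Require Import measurable_realfun.
From mathcomp Require Import ring lra.
Set Implicit Arguments.
Unset Strict Implicit.
Unset Printing Implicit Defensive.
Import Order.TTheory GRing.Theory Num.Theory.
Import numFieldNormedType.Exports.
Local Open Scope classical_set_scope.
Local Open Scope ring_scope.

(** Rescaling turns a design with criterion [psi] inside a small cell, where the
    charge is nearly a constant [q_c], into a packing of a box of side
    proportional to [1 / (psi * q_c ^ 2)] by points at generalized distance at
    least [1].  The largest cardinal [M T] of such a packing of the box of side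
    [T] satisfies [M (K * t) <= K ^ p * M t], hence [M T / T ^ p] tends to a
    constant [Delta], which is also its infimum.

    So a cell of volume [v] contains at most about
    [Delta * v / (psi * q_c ^ 2) ^ p] points of the optimal design.  Conversely,
    optimal packings of slightly shrunken cells, the gaps keeping points of
    distinct cells apart, together form a design with criterion slightly above
    [psi]; by optimality it has fewer than [n] points, which bounds [psi ^ p]
    from below.  Dividing, the proportion of points in a cell is asymptotically
    at most its mass for the density proportional to [1 / q ^ (2 * p)].  As both
    families of masses sum to one, these upper bounds alone give weak
    convergence: apply them to a test function and to its opposite. *)

Local Notation coord := Defs.coord.

(** * Packings of boxes *)

(** For [a] in [[0, 1]], induction keeps [(1 + a) ^+ K] below the chord [1 + (2 ^+ K - 1) * a]. A
    target error [e] is thus converted into a slack [a] that can be spent [K] times. *)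
Lemma exists_expr1D_le (R : realFieldType) (K : nat) (e : R) :
  0 < e -> exists2 a : R, 0 < a <= 1 & (1 + a) ^+ K <= 1 + e.
Proof.
move=> e0.
have bernoulli (a : R) : 0 <= a <= 1 -> (1 + a) ^+ K <= 1 + (2 ^+ K - 1) * a.
  move=> /andP[a0 a1]; elim: K => [|K IH].
    by rewrite !expr0 subrr mul0r addr0.
  rewrite exprSr (le_trans (ler_wpM2r _ IH)) ?addr_ge0// exprS.
  have X1 : 0 <= 2 ^+ K - 1 :> R by rewrite subr_ge0 exprn_ege1// ler1n.
  have a1' : 0 <= 1 - a by rewrite subr_ge0.
  have := mulr_ge0 (mulr_ge0 X1 a0) a1'; nra.
have K0 : 0 < 2 ^+ K :> R by rewrite exprn_gt0.
exists (Num.min 1 (e / 2 ^+ K)).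
  by rewrite lt_min ltr01 divr_gt0//= ge_min lexx.
set a := Num.min _ _.
have a1 : a <= 1 by rewrite ge_min lexx.
have a0 : 0 < a by rewrite lt_min ltr01 divr_gt0.
apply: le_trans (bernoulli a _) _; first by rewrite a1 ltW.
rewrite lerD2l mulrBl mul1r (le_trans (y := 2 ^+ K * a)) ?gerBl ?(ltW a0)//.
by rewrite mulrC -ler_pdivlMr// ge_min lexx orbT.
Qed.

Section packing.
Context (R : realType) (p : nat) (delta : 'rV[R]_p -> R) (c : R).
Hypothesis c_gt0 : 0 < c.
(** Only homogeneity and a two-sided comparison with the sup norm are assumed, so that [s < 1],
    where the triangle inequality may fail, is covered. *)
Hypothesis deltaZ : forall (a : R) (u : 'rV[R]_p), 0 <= a -> delta (a *: u) = a * delta u.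
Hypothesis delta_ge : forall (u : 'rV[R]_p) j, c * `|u ord0 j| <= delta u.
Hypothesis delta_le : forall (u : 'rV[R]_p) (a : R), 0 <= a ->
  (forall j, `|u ord0 j| <= a) -> delta u <= a.

Definition packing (T : R) (k : nat) : Prop :=
  exists x : 'I_k -> 'rV[R]_p, (forall i j, 0 <= x i ord0 j <= T) /\
    forall i i', i != i' -> 1 <= delta (x i - x i').

(** Translate by [- b], then divide by [r]. *)
Lemma packing_of_points (I : finType) (A : {set I}) (x : I -> 'rV[R]_p)
    (b : 'rV[R]_p) (r T : R) : 0 < r ->
  {in A, forall i j, b ord0 j <= x i ord0 j <= b ord0 j + T} ->
  {in A &, forall i i', i != i' -> r <= delta (x i - x i')} ->
  packing (T / r) #|A|.
Proof.
move=> r0 xb xr; exists (fun i => r^-1 *: (x (enum_val i) - b)); split.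
  move=> i j; rewrite !mxE.
  have /andP[h1 h2] := xb _ (enum_valP i) j.
  rewrite mulr_ge0 ?subr_ge0 ?invr_ge0 ?(ltW r0)//=.
  by rewrite mulrC ler_pM2r ?invr_gt0// lerBlDl.
move=> i i' ii'; rewrite -scalerBr opprB addrA addrNK deltaZ ?invr_ge0 ?(ltW r0)//.
rewrite mulrC ler_pdivlMr// mul1r xr ?enum_valP//.
by apply: contraNneq ii' => /enum_val_inj ->.
Qed.

(** Cut the box of side [t * K] into [K ^ p] boxes of side [t]: each one carries a packing, hence at
    most [N] points. *)
Lemma packing_cover (T t : R) (K N k : nat) : 0 < t -> T <= t * K%:R ->
  (0 < K)%N -> (forall k', packing t k' -> (k' <= N)%N) ->
  packing T k -> (k <= K ^ p * N)%N.
Proof.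
case: K => // K t0 TK _ tN [x [x01 x1]].
(* There are now [K.+1] boxes per axis; the cap at [K] puts the face [t * K.+1] in the last one. *)
pose cell i : {ffun 'I_p -> 'I_K.+1} :=
  [ffun j => inord (minn K (Num.truncn (x i ord0 j / t)))].
have xcell i j : t * (cell i j)%:R <= x i ord0 j <= t * (cell i j)%:R + t.
  have /andP[x0 xT] := x01 i j.
  have y0 : 0 <= x i ord0 j / t by rewrite divr_ge0 ?(ltW t0).
  have yK : x i ord0 j / t <= K.+1%:R by rewrite ler_pdivrMr// mulrC (le_trans xT).
  rewrite ffunE inordK ?ltnS ?geq_minl//.
  suff /andP[h1 h2] : (minn K (Num.truncn (x i ord0 j / t)))%:R <=
      x i ord0 j / t <= (minn K (Num.truncn (x i ord0 j / t)))%:R + 1.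
    rewrite -[X in _ <= X <= _](divfK (lt0r_neq0 t0)) mulrC ler_pM2r// h1.
    by rewrite -[X in _ <= _ + X]mul1r -mulrDl ler_pM2r.
  have /andP[h1 h2] := truncn_itv y0.
  rewrite -!natr1 in h2 yK.
  case: leqP => [h|h]; last by rewrite h1 ltW.
  by rewrite yK (le_trans _ h1) ?ler_nat.
rewrite -[k]card_ord -sum1_card (partition_big cell xpredT)//=.
apply: (@leq_trans (\sum_(C : {ffun 'I_p -> 'I_K.+1}) N)); last first.
  by rewrite sum_nat_const card_ffun !card_ord.
apply: leq_sum => C _; rewrite sum1dep_card; apply: tN; rewrite -[t]divr1.
apply: (packing_of_points (x := x) (b := \row_j (t * (C j)%:R))) => // i.
  by rewrite inE => /eqP <- j; rewrite mxE.
by move=> j _ _; exact: x1.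
Qed.

(** A box of side [1 / 2] holds at most one point, because [delta] is below the sup norm;
    [packing_cover] extends the bound to any side. *)
Lemma packing_bounded (T : R) : exists N, forall k, packing T k -> (k <= N)%N.
Proof.
exists ((Num.truncn (T / 2^-1)).+1 ^ p * 1)%N => k.
apply: (@packing_cover T 2^-1) => //.
  by rewrite mulrC -ler_pdivrMr// ltW// truncnS_gt.
move=> k' [x [x0 x1]]; rewrite leqNgt; apply/negP => k'1.
have k'0 : (0 < k')%N by rewrite ltnW.
have := x1 (Ordinal k'0) (Ordinal k'1) isT.
apply/negP; rewrite -ltNge; apply: (@le_lt_trans _ _ 2^-1); last by lra.
apply: delta_le; first by lra.
move=> j; rewrite !mxE ler_norml.
have := x0 (Ordinal k'0) j; have := x0 (Ordinal k'1) j; lra.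
Qed.

Lemma packing_max (T : R) : exists M, packing T M /\
  forall k, packing T k -> (k <= M)%N.
Proof.
have [N TN] := packing_bounded T.
have ex : exists k, `[< packing T k >].
  by exists 0%N; apply/asboolP; exists (fun=> 0); split=> -[].
have ub k : `[< packing T k >] -> (k <= N)%N by move=> /asboolP; exact: TN.
by case: (ex_maxnP ex ub) => M /asboolP TM h; exists M; split=> // k kT;
  apply/h/asboolP.
Qed.

(** The grid of step [c^-1] is a packing by [delta_ge], as distinct grid points differ by at least
    one step in some coordinate. This makes the density [Delta] positive. *)
Lemma packing_grid (T : R) : 0 < T ->
  exists2 k, packing T k & (c * T) ^+ p <= k%:R.
Proof.
move=> T0; set K := Num.truncn (c * T).
have cT0 : 0 <= c * T by rewrite mulr_ge0 ?ltW.
exists (K.+1 ^ p)%N; last first.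
  by rewrite natrX lerXn2r ?nnegrE ?ler0n// ltW// truncnS_gt.
have -> : (K.+1 ^ p)%N = #|[set: {ffun 'I_p -> 'I_K.+1}]%SET|.
  by rewrite cardsT card_ffun !card_ord.
rewrite -[T]divr1.
apply: (packing_of_points (b := 0)
  (x := fun f : {ffun 'I_p -> 'I_K.+1} => \row_j (c^-1 * (f j)%:R))) => //.
  move=> f _ j; rewrite !mxE add0r mulr_ge0 ?invr_ge0 ?(ltW c_gt0)//=.
  rewrite mulrC ler_pdivrMr// mulrC (le_trans (y := K%:R))//.
    by rewrite ler_nat -ltnS.
  by have /andP[] := truncn_itv cT0.
move=> f g _ _ fg.
have [j fgj] : exists j, f j != g j.
  apply/existsP; apply: contra_neqT fg; rewrite negb_exists => /forallP h.
  by apply/ffunP => j; apply/eqP; rewrite -[_ == _]negbK.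
apply: le_trans (delta_ge _ j); rewrite !mxE -mulrBr normrM gtr0_norm ?invr_gt0//.
rewrite mulrA divff ?gt_eqF// mul1r.
rewrite -[(f j)%:R]/((f j)%:Z%:~R) -[(g j)%:R]/((g j)%:Z%:~R) -intrB -intr_norm.
by rewrite ler1z -gtz0_ge1 normr_gt0 subr_eq0 eqz_nat.
Qed.

(* [Delta] is the infimum of [M T / T ^+ p], where [M T] is the largest cardinal of a
   packing; by [packing_cover] it is also the limit. *)
Lemma packing_density : exists2 Delta : R, 0 < Delta &
  (forall T, 0 < T -> exists2 k, packing T k & Delta * T ^+ p <= k%:R) /\
  (forall e, 0 < e -> exists2 T0, 0 < T0 & forall T k, T0 <= T ->
    packing T k -> k%:R <= (1 + e) * (Delta * T ^+ p)).
Proof.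
have [M MP] := choice packing_max.
pose S := [set (M T)%:R / T ^+ p | T in [set T : R | 0 < T]].
have Slb y : S y -> c ^+ p <= y.
  move=> [T /= T0 <-]; have [k kT kc] := packing_grid T0.
  rewrite ler_pdivlMr ?exprn_gt0// -exprMn (le_trans kc)// ler_nat.
  exact: (MP T).2.
have S0 : S !=set0 by exists ((M 1)%:R / 1 ^+ p); exists 1 => //=.
have Sinf : has_inf S by split=> //; exists (c ^+ p) => y; exact: Slb.
have D0 : 0 < inf S.
  by apply: (@lt_le_trans _ _ (c ^+ p)); [rewrite exprn_gt0|apply: lb_le_inf].
exists (inf S) => //; split=> [T T0|e e0].
  exists (M T); first exact: (MP T).1.
  rewrite -ler_pdivlMr ?exprn_gt0//; apply: ge_inf; first by case: Sinf.
  by exists T.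
(* Of the [p.+1] factors [1 + a], one pays for taking [t] near the infimum and [p] for rounding
   [T / t] up. *)
have [a /andP[a0 a1] ae] := exists_expr1D_le p.+1 e0.
have [_ [t /= t0 <-] tD] : exists2 y, S y & y < (1 + a) * inf S.
  have [|y Sy yS] := inf_adherent (eps := a * inf S) _ Sinf; first exact: mulr_gt0.
  by exists y => //; rewrite mulrDl mul1r.
(* For [T] at least [t / a], rounding [T / t] up adds at most [1 <= a * (T / t)]. *)
exists (t / a) => [|T k tT kT]; first exact: divr_gt0.
have T0 : 0 < T by apply: lt_le_trans tT; rewrite divr_gt0.
have Tt0 : 0 <= T / t by rewrite divr_ge0 ?ltW.
have kM := packing_cover t0 _ isT (MP t).2 kT (K := (Num.truncn (T / t)).+1).
have /andP[trT _] := truncn_itv Tt0.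
have Ka : (Num.truncn (T / t)).+1%:R <= (1 + a) * (T / t).
  rewrite -natr1 mulrDl mul1r lerD// mulrA ler_pdivlMr// mul1r mulrC.
  by rewrite -ler_pdivrMr.
apply: (@le_trans _ _ ((1 + a) ^+ p.+1 * (inf S * T ^+ p))); last first.
  by rewrite ler_wpM2r// mulr_ge0 ?exprn_ge0 ?ltW.
apply: (@le_trans _ _ (((Num.truncn (T / t)).+1 ^ p * M t)%:R)).
  by rewrite ler_nat kM// -ler_pdivrMl ?[_^-1 * _]mulrC ?ltW ?truncnS_gt.
rewrite natrM natrX.
have MD : (M t)%:R <= (1 + a) * inf S * t ^+ p.
  by rewrite -ler_pdivrMr ?exprn_gt0// ltW.
have KD : (Num.truncn (T / t)).+1%:R ^+ p <= ((1 + a) * (T / t)) ^+ p.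
  by rewrite lerXn2r ?nnegrE ?ler0n// mulr_ge0// addr_ge0// ltW.
apply: le_trans (ler_pM _ _ KD MD) _; rewrite ?exprn_ge0 ?ler0n//.
rewrite !exprMn exprVn exprS le_eqVlt; apply/orP; left; apply/eqP; field.
by rewrite expf_neq0// gt_eqF.
Qed.
End packing.

(** * Topology of the unit cube *)

Lemma dist_max_min_le (R : realFieldType) (a b : R) :
  `|Num.max 0 (Num.min 1 a) - Num.max 0 (Num.min 1 b)| <= `|a - b|.
Proof.
wlog ab : a b / a <= b.
  by move=> h; have [/h//|/ltW/h] := leP a b; rewrite distrC [leRHS]distrC.
have max0_le (x y : R) : x <= y -> 0 <= Num.max 0 y - Num.max 0 x <= y - x.
  by move=> xy; case: (leP 0 x) => ?; case: (leP 0 y) => ?; lra.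
have min1_le (x y : R) : x <= y -> 0 <= Num.min 1 y - Num.min 1 x <= y - x.
  by move=> xy; case: (leP 1 x) => ?; case: (leP 1 y) => ?; lra.
have /andP[h1 h2] := min1_le _ _ ab; rewrite subr_ge0 in h1.
have /andP[h3 h4] := max0_le _ _ h1.
by rewrite distrC [leRHS]distrC (ger0_norm h3) ger0_norm ?subr_ge0// (le_trans h4).
Qed.

Section cube_topology.
Context (R : realType) (p : nat).

Lemma coord_itv (x : cube R p) i : 0 <= coord x i <= 1.
Proof. by have := set_mem (svalP x) i; rewrite /= in_itv. Qed.

(** Together with [to_cube], this is a retraction of the whole space onto the cube; it builds points
    of the cube from arbitrary vectors and transfers compactness. *)
Definition clamp (u : 'rV[R]_p) : 'rV[R]_p :=
  \row_i Num.max 0 (Num.min 1 (u ord0 i)).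

Lemma clamp_cube (u : 'rV[R]_p) : clamp u \in unit_cube R p.
Proof.
apply/mem_set => i; rewrite mxE /= in_itv /= le_max lexx ge_max ler01/=.
by rewrite ge_min lexx.
Qed.

Definition to_cube (u : 'rV[R]_p) : cube R p := exist _ (clamp u) (clamp_cube u).

Lemma coord_to_cube (u : 'rV[R]_p) i : 0 <= u ord0 i <= 1 -> coord (to_cube u) i = u ord0 i.
Proof. by move=> /andP[u0 u1]; rewrite /coord /= mxE (min_r u1) (max_r u0). Qed.

Lemma to_cube_val (x : cube R p) : to_cube (sval x) = x.
Proof.
apply: val_inj; apply/rowP => i; rewrite -[LHS]/(coord (to_cube _) i).
by rewrite coord_to_cube//; exact: coord_itv.
Qed.

Lemma nbhs_coordP (x : cube R p) (A : set (cube R p)) : nbhs x A ->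
  exists2 e : R, 0 < e & forall y, (forall i, `|coord x i - coord y i| < e) -> A y.
Proof.
rewrite nbhsE => -[U [[V oV VU] Ux] UA].
have : nbhs (sval x) V by apply: open_nbhs_nbhs; split=> //; move: Ux; rewrite -VU.
move=> /nbhs_ballP[e /= e0 xeV]; exists e => // y xy; apply: UA; rewrite -VU.
by apply: xeV; split=> // i j; rewrite ord1; exact: xy.
Qed.

Lemma to_cube_continuous : continuous to_cube.
Proof.
move=> u A /nbhs_coordP[e e0 eA]; apply/nbhs_ballP; exists e => //= v [_ uv].
apply: eA => i; rewrite /coord /= !mxE.
exact: le_lt_trans (dist_max_min_le _ _) (uv ord0 i).
Qed.

Lemma compact_cube : compact [set: cube R p].
Proof.
rewrite (_ : [set: _] = to_cube @`
    [set x : 'rV[R]_p | forall i, [set` `[0, 1]] (x ord0 i)]); last first.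
  apply/seteqP; split=> // x _; exists (sval x); last exact: to_cube_val.
  exact: (set_mem (svalP x)).
apply: continuous_compact; first exact/continuous_subspaceT/to_cube_continuous.
have K := @rV_compact R p (fun=> [set` `[0, 1]]) (fun=> @segment_compact R 0 1).
refine K.
Qed.

Lemma cube_min (h : cube R p -> R) : continuous h ->
  exists x, forall y, h x <= h y.
Proof.
move=> ch; have [x _ xh] := compact_EVT_min (ex_intro _ point I) compact_cube
  (continuous_subspaceT ch).
by exists x => y; rewrite xh// in_setT.
Qed.

Lemma cube_max (h : cube R p -> R) : continuous h ->
  exists x, forall y, h y <= h x.
Proof.
move=> ch; have [x _ xh] := compact_EVT_max (ex_intro _ point I) compact_cube
  (continuous_subspaceT ch).
by exists x => y; rewrite xh// in_setT.
Qed.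

Lemma cube_bounded (h : cube R p -> R) : continuous h ->
  exists M, forall y, `|h y| <= M.
Proof.
move=> ch; have [x xh] : exists x, forall y, `|h y| <= `|h x|.
  apply: (@cube_max (fun x => `|h x|)) => x.
  by apply: continuous_comp (ch x) _; exact: norm_continuous.
by exists `|h x|.
Qed.

Lemma coord_cvg (x : cube R p) (e : R) : 0 < e ->
  \forall y \near x, forall i, `|coord x i - coord y i| < e.
Proof.
move=> e0; have : nbhs x (set_val @^-1` ball (set_val x : 'rV[R]_p) e).
  have N := @initial_continuous _ _ (set_val : cube R p -> 'rV[R]_p) x.
  exact: N (nbhsx_ballx (set_val x : 'rV[R]_p) e e0).
apply: (@filterS _ _ (@nbhs_filter (cube R p) x)) => y [_ xy] i; exact: xy.
Qed.

Lemma continuous_coord (i : 'I_p) : continuous (fun x : cube R p => coord x i).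
Proof.
move=> x A /nbhs_ballP[e e0 eA]; have := coord_cvg x e0.
by apply: (@filterS _ _ (@nbhs_filter (cube R p) x)) => y xy; exact/eA/xy.
Qed.

(** Near-covering form of compactness: a radius that works locally around each point yields one that
    works on the whole cube. *)
Lemma cube_unif_continuous (h : cube R p -> R) (e : R) :
  continuous h -> 0 < e -> exists2 d : R, 0 < d &
    forall x y, (forall i, `|coord x i - coord y i| < d) -> `|h x - h y| < e.
Proof.
move=> ch e0.
pose Q (d : R) x := forall y, (forall i, `|coord x i - coord y i| < d) ->
  `|h x - h y| < e.
have : \forall d \near 0^'+, [set: cube R p] `<=` Q d.
  apply: (compact_near_coveringP _).1; first exact: compact_cube.
  move=> x _; have e20 : 0 < e / 2 by rewrite divr_gt0.
  have [r r0 xr] := nbhs_coordP (ch x _ (nbhsx_ballx (h x) _ e20)).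
  have r20 : 0 < r / 2 by rewrite divr_gt0.
  exists ([set y | forall i, `|coord x i - coord y i| < r / 2],
          [set d | d < r / 2]).
    by split; [exact: coord_cvg|exact: nbhs_right_lt].
  move=> [y d] [/= xy dr] z yz; rewrite (splitr e).
  rewrite -(subrK (h x) (h y)) -addrA (le_lt_trans (ler_normD _ _))// ltrD//.
    rewrite distrC xr// => i; rewrite (lt_le_trans (xy i))//; lra.
  rewrite xr// => i; rewrite (splitr r).
  rewrite -(subrK (coord y i) (coord x i)) -addrA.
  by rewrite (le_lt_trans (ler_normD _ _))// ltrD// (lt_trans (yz i)).
move=> /(filterI (nbhs_right_gt 0)) /filter_ex[d [d0 dQ]].
by exists d => // x y; exact: dQ.
Qed.

Lemma measurable_fun_continuous (h : cube R p -> R) : continuous h ->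
  measurable_fun [set: borel (cube R p)] (h : borel (cube R p) -> measurableTypeR R).
Proof.
move=> /continuousP ch; apply: (measurability _ (RGenOpens.measurableE R)).
move=> _ [_ [a [b ->] <-]]; rewrite setTI; apply: sub_sigma_algebra.
exact/ch/interval_open.
Qed.

End cube_topology.

(** * Grids of cells *)

Section grid.
Context (R : realType) (p m : nat).
Local Notation M := (m.+1%:R : R).

(** The cap at [m] assigns [y = 1] to the last interval. *)
Definition axis_index (y : R) : 'I_m.+1 := inord (minn m (Num.truncn (M * y))).

Definition cell_index (x : cube R p) : {ffun 'I_p -> 'I_m.+1} :=
  [ffun i => axis_index (coord x i)].

Definition cell (c : {ffun 'I_p -> 'I_m.+1}) : set (borel (cube R p)) :=
  [set x | cell_index x = c].

Definition corner (c : {ffun 'I_p -> 'I_m.+1}) : cube R p :=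
  to_cube (\row_i ((c i)%:R / M)).

(** The last interval is closed, so that these intervals partition [[0, 1]]. *)
Definition axis_itv (k : 'I_m.+1) : interval R :=
  Interval (BLeft (k%:R / M)) (BSide (k != m :> nat) (k.+1%:R / M)).

Let M0 : 0 < M. Proof. by rewrite ltr0n. Qed.

Lemma axis_indexE (y : R) (k : 'I_m.+1) : 0 <= y <= 1 ->
  (axis_index y == k) = (y \in axis_itv k).
Proof.
move=> /andP[y0 y1]; have My0 : 0 <= M * y by rewrite mulr_ge0 ?(ltW M0).
rewrite -val_eqE /axis_index /= inordK ?ltnS ?geq_minl//.
have -> : (y \in axis_itv k) =
    (k%:R <= M * y) && (M * y < k.+1%:R ?<= if (k == m :> nat)).
  by rewrite /axis_itv in_itv /= ler_pdivrMr// lteif_pdivlMr// mulrC negbK.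
have [km|km] := eqVneq (k : nat) m.
  rewrite km /= [X in _ && X](_ : _ = true) ?andbT.
    by rewrite (sameP eqP minn_idPl) truncn_ge_nat.
  by rewrite -[leRHS]mulr1 ler_pM2l.
have km' : (k < m)%N by rewrite ltn_neqAle km -ltnS ltn_ord.
rewrite /= -truncn_eq//.
by rewrite /minn; case: ltnP => // mt; rewrite (gtn_eqF km') (gtn_eqF (ltn_trans km' mt)).
Qed.

Lemma axis_itv01 (k : 'I_m.+1) (y : R) : y \in axis_itv k -> 0 <= y <= 1.
Proof.
rewrite in_itv /= => /andP[ky /lteifW yk]; apply/andP; split.
  by apply: le_trans ky; rewrite divr_ge0 ?ler0n.
by rewrite (le_trans yk)// ler_pdivrMr// mul1r ler_nat.
Qed.

Lemma cell_coord (x : cube R p) i :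
  (cell_index x i)%:R / M <= coord x i <= (cell_index x i)%:R / M + M^-1.
Proof.
have := axis_indexE (cell_index x i) (coord_itv x i); rewrite ffunE eqxx.
move=> /esym; rewrite in_itv /= => /andP[-> /lteifW].
by rewrite -natr1 mulrDl mul1r.
Qed.

Lemma coord_corner c i : coord (corner c) i = (c i)%:R / M.
Proof.
rewrite coord_to_cube mxE// divr_ge0 ?ler0n//=.
by rewrite ler_pdivrMr// mul1r ler_nat ltnW.
Qed.

Lemma corner_near (x : cube R p) i :
  `|coord x i - coord (corner (cell_index x)) i| <= M^-1.
Proof.
have /andP[h1 h2] := cell_coord x i; rewrite coord_corner ger0_norm ?subr_ge0//.
by rewrite lerBlDl.
Qed.

Lemma cellE c : cell c = \bigcap_(i in [set: 'I_p])
  ((fun x => coord x i) @^-1` [set` axis_itv (c i)]).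
Proof.
apply/seteqP; split=> [x <- i _|x cx] /=.
  by rewrite -axis_indexE ?coord_itv// ffunE.
apply/ffunP => i; apply/eqP; rewrite ffunE axis_indexE ?coord_itv//; exact: cx.
Qed.

Lemma measurable_cell c : measurable (cell c).
Proof.
rewrite cellE; apply: fin_bigcap_measurable => // i _.
rewrite -[X in measurable X]setTI.
have mi : measurable ([set` axis_itv (c i)] : set (measurableTypeR R)).
  exact: measurable_itv.
exact: (measurable_fun_continuous (@continuous_coord R p i)) measurableT _ mi.
Qed.

Lemma lebesgue_cube_cell c : lebesgue_cube (cell c) = ((M^-1) ^+ p)%:E.
Proof.
rewrite /lebesgue_cube (_ : _ @` _ =
    [set t | forall i, [set` axis_itv (c i)] (tnth t i)]).
  transitivity (\prod_(i < p) lebesgue_measure [set` axis_itv (c i)])%E.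
    have mc i : measurable ([set` axis_itv (c i)] : set (measurableTypeR R)).
      exact: measurable_itv.
    exact: (power_measure_box lebesgue_measure mc).
  under eq_bigr => i _.
    rewrite lebesgue_measure_itv /= lte_fin ltr_pM2r ?invr_gt0// ltr_nat ltnSn.
    rewrite -EFinB -mulrBl -natrB// subSnn mul1r. over.
  by rewrite prodEFin prodr_const card_ord.
apply/seteqP; split=> [_ [x /= xc <-] i|t ct].
  by rewrite tnth_mktuple; move: xc; rewrite cellE => /(_ i I).
have tE i : coord (to_cube (\row_i (tnth t i : R))) i = tnth t i.
  by rewrite coord_to_cube mxE//; exact: axis_itv01 (ct i).
exists (to_cube (\row_i (tnth t i : R))).
  by rewrite cellE => i _; rewrite /= tE; exact: ct.
by apply: eq_from_tnth => i; rewrite tnth_mktuple tE.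
Qed.

Lemma trivIset_cell (s : set {ffun 'I_p -> 'I_m.+1}) : trivIset s cell.
Proof. by move=> c c' _ _ [x [<- <-]]. Qed.

Lemma bigsetU_cell : \big[setU/set0]_(c <- index_enum {ffun 'I_p -> 'I_m.+1}) cell c = setT.
Proof.
apply/seteqP; split=> // x _; rewrite -bigcup_seq; exists (cell_index x) => //=.
by rewrite mem_index_enum.
Qed.

Lemma ge0_integral_cells (mu : {measure set (borel (cube R p)) -> \bar R})
    (f : borel (cube R p) -> \bar R) :
  measurable_fun [set: borel (cube R p)] f -> (forall x, 0 <= f x)%E ->
  (\int[mu]_x f x = \sum_c \int[mu]_(x in cell c) f x)%E.
Proof.
move=> mf f0; rewrite -bigsetU_cell ge0_integral_bigsetU//.
- exact: measurable_cell.
- exact: index_enum_uniq.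
- exact: trivIset_cell.
- by rewrite bigsetU_cell.
Qed.

Lemma measure_cells (mu : {measure set (borel (cube R p)) -> \bar R}) :
  (mu setT = \sum_c mu (cell c))%E.
Proof.
rewrite -[LHS]mul1e -integral_cst// (ge0_integral_cells mu (f := cst 1%E))//.
by apply: eq_bigr => c _; rewrite integral_cst ?mul1e//; exact: measurable_cell.
Qed.

End grid.

Lemma near_corner (R : realType) (p : nat) (h : cube R p -> R) (e : R) :
  continuous h -> 0 < e ->
  \forall m \near \oo, forall x, `|h x - h (corner R (cell_index m x))| < e.
Proof.
move=> ch e0; have [d d0 hd] := cube_unif_continuous ch e0.
have := near_infty_natSinv_lt (PosNum d0); apply: filterS => m /= md x.
by apply: hd => i; exact: le_lt_trans (corner_near _ _ _) md.
Qed.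

(** * Designs and packings *)

Section gen_norm.
Context (R : realType) (p : nat) (s : R).
Hypotheses (p0 : (0 < p)%N) (s0 : 0 < s).

(** The generalized distance as a function of the difference, on all row vectors, so that packings
    can be rescaled outside the cube. *)
Definition gen_norm (u : 'rV[R]_p) : R :=
  (p%:R^-1 * \sum_(l < p) `|u ord0 l| `^ s) `^ s^-1.

Lemma gen_distE (x y : cube R p) : gen_dist s x y = gen_norm (sval x - sval y).
Proof.
by rewrite /gen_dist /gen_norm; under [in RHS]eq_bigr do rewrite !mxE.
Qed.

Let pV0 : 0 <= p%:R^-1 :> R. Proof. by rewrite invr_ge0. Qed.

Let powRK (a : R) : 0 <= a -> (a `^ s) `^ s^-1 = a.
Proof. by move=> a0; rewrite -powRrM divff ?gt_eqF// powRr1. Qed.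

Let sum_ge0 (u : 'rV[R]_p) : 0 <= \sum_(l < p) `|u ord0 l| `^ s.
Proof. by apply: sumr_ge0 => l _; exact: powR_ge0. Qed.

Lemma gen_normZ (a : R) (u : 'rV[R]_p) : 0 <= a ->
  gen_norm (a *: u) = a * gen_norm u.
Proof.
move=> a0; rewrite /gen_norm.
under eq_bigr do rewrite mxE normrM (ger0_norm a0) powRM//.
rewrite -mulr_sumr mulrCA powRM ?powR_ge0 ?mulr_ge0//.
by rewrite powRK.
Qed.

(** Keep only the term [j] of the sum. *)
Lemma gen_norm_ge (u : 'rV[R]_p) j :
  p%:R^-1 `^ s^-1 * `|u ord0 j| <= gen_norm u.
Proof.
rewrite -{1}(powRK (normr_ge0 (u ord0 j))) -powRM ?powR_ge0//.
apply: ge0_ler_powR; rewrite ?invr_ge0 ?(ltW s0)// ?nnegrE ?mulr_ge0 ?powR_ge0//.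
rewrite ler_wpM2l// (bigD1 j)//= lerDl.
by apply: sumr_ge0 => l _; exact: powR_ge0.
Qed.

(** A power mean lies below the maximum. *)
Lemma gen_norm_le (u : 'rV[R]_p) (a : R) : 0 <= a ->
  (forall j, `|u ord0 j| <= a) -> gen_norm u <= a.
Proof.
move=> a0 ua; rewrite -[leRHS](powRK a0).
apply: ge0_ler_powR; rewrite ?invr_ge0 ?(ltW s0)// ?nnegrE ?mulr_ge0 ?powR_ge0//.
rewrite ler_pdivrMl ?ltr0n//.
apply: (@le_trans _ _ (\sum_(l < p) a `^ s)); last first.
  by rewrite sumr_const card_ord mulr_natl.
by apply: ler_sum => l _; apply: ge0_ler_powR => //; rewrite ?nnegrE// ltW.
Qed.

End gen_norm.

Section separated.
Context (R : realType) (p : nat) (q : cube R p -> R) (s : R).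
Hypotheses (p0 : (0 < p)%N) (s0 : 0 < s) (q0 : forall x, 0 < q x).

(** A real threshold on pairs replaces the minimum in [\bar R]; [separatedP] relates the two. *)
Definition charge_separated (r : R) (D : {fset cube R p}) : Prop :=
  forall x y, x \in D -> y \in D -> x != y -> r <= charged_dist q s x y.

Local Notation c0 := (p%:R^-1 `^ s^-1 : R).
Let c0_gt0 : 0 < c0. Proof. by rewrite powR_gt0// invr_gt0 ltr0n. Qed.

Lemma separatedP (r : R) (D : {fset cube R p}) :
  charge_separated r D <-> (r%:E <= med_criterion q s D)%E.
Proof.
split=> [rD|rD x y xD yD xy].
  rewrite /med_criterion big_seq; apply: le_bigmin => [|x xD]; first exact: leey.
  rewrite big_seq_cond; apply: le_bigmin => [|y /andP[yD yx]]; first exact: leey.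
  by rewrite lee_fin rD// eq_sym.
rewrite -lee_fin (le_trans rD)//.
apply: le_trans (@ge_bigmin_seq _ _ _ D _ x xpredT _ xD isT) _.
by apply: (@ge_bigmin_seq _ _ _ D _ y (fun y => y != x)); rewrite // eq_sym.
Qed.

Lemma charged_dist_gt0 (x y : cube R p) : x != y -> 0 < charged_dist q s x y.
Proof.
move=> xy; rewrite divr_gt0 ?mulr_gt0// gen_distE.
have [i xyi] : exists i, sval x ord0 i != sval y ord0 i.
  apply/existsP; apply: contra_neqT xy; rewrite negb_exists => /forallP h.
  by apply: val_inj; apply/rowP => i; apply/eqP; rewrite -[_ == _]negbK.
apply: lt_le_trans (gen_norm_ge s0 _ i).
by rewrite mulr_gt0// normr_gt0 !mxE subr_eq0.
Qed.

Lemma med_criterion_fin (D : {fset cube R p}) : (2 <= #|` D|)%N ->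
  exists2 psi : R, 0 < psi & med_criterion q s D = psi%:E.
Proof.
move=> D2.
have : (0 < med_criterion q s D)%E.
  apply: lt_bigmin => // x _; apply: lt_bigmin => // y yx.
  by rewrite lte_fin charged_dist_gt0// eq_sym.
have [x [y [xD yD xy]]] : exists x y, [/\ x \in D, y \in D & x != y].
  have uD := fset_uniq D; have memD z : z \in enum_fset D -> z \in D by [].
  move: D2 uD memD; case: (enum_fset D) => [|x [|y l]] //= _ /andP[xyl _] memD.
  exists x, y; split; first by rewrite memD// mem_head.
    by rewrite memD// !inE eqxx orbT.
  by apply: contraNneq xyl => ->; rewrite mem_head.
have : (med_criterion q s D <= (charged_dist q s x y)%:E)%E.
  apply: le_trans (@ge_bigmin_seq _ _ _ D _ x xpredT _ xD isT) _.
  by apply: (@ge_bigmin_seq _ _ _ D _ y (fun y => y != x)); rewrite // eq_sym.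
by case: med_criterion => // psi _ psi0; exists psi.
Qed.

(** The cell is a box of side [m.+1%:R^-1] where the product of two charges is at least [Q ^+ 2], so
    its points are [psi * Q ^+ 2] apart; dividing by this distance gives the packing. *)
Lemma packing_of_separated (m : nat) (D : {fset cube R p}) (psi Q : R)
    (c : {ffun 'I_p -> 'I_m.+1}) : 0 < psi -> 0 < Q -> charge_separated psi D ->
  (forall x, cell_index m x = c -> Q <= q x) ->
  packing (@gen_norm R p s) (m.+1%:R^-1 / (psi * Q ^+ 2))
    #|[set x : D | cell_index m (val x) == c]%SET|.
Proof.
move=> psi0 Q0 Dpsi cQ.
apply: (packing_of_points (@gen_normZ R p s s0) (x := fun x : D => sval (val x))
  (b := \row_i ((c i)%:R / m.+1%:R))).
- by rewrite mulr_gt0// exprn_gt0.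
- by move=> x; rewrite inE => /eqP <- i; rewrite mxE; exact: cell_coord.
- move=> x y; rewrite !inE => /eqP xc /eqP yc xy.
  have xy' : fsval x != fsval y by rewrite (inj_eq val_inj).
  have := Dpsi _ _ (fsvalP x) (fsvalP y) xy'.
  rewrite /charged_dist gen_distE ler_pdivlMr ?mulr_gt0//; apply: le_trans.
  by rewrite ler_pM2l// expr2 ler_pM ?(ltW Q0)// cQ.
Qed.

(* The points of a cell fill a box of side [a] at its lower corner, so that points
   of distinct cells have a coordinate differing by at least [m.+1%:R^-1 - a]. *)
Lemma exists_separated (m : nat) (r a Qm : R) (Q : {ffun 'I_p -> 'I_m.+1} -> R)
    (k : {ffun 'I_p -> 'I_m.+1} -> nat) (n : nat) :
  0 < r -> 0 <= a -> r * Qm ^+ 2 <= c0 * (m.+1%:R^-1 - a) ->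
  (forall c, 0 < Q c <= Qm) -> (forall x, q x <= Q (cell_index m x)) ->
  (forall c, packing (@gen_norm R p s) (a / (r * Q c ^+ 2)) (k c)) ->
  (n <= \sum_c k c)%N ->
  exists2 D : {fset cube R p}, #|` D| = n & charge_separated r D.
Proof.
move=> r0 a0 gap Q0 qQ pk nk.
pose M : R := m.+1%:R; have M0 : 0 < M by rewrite ltr0n.
have rQ0 c : 0 < r * Q c ^+ 2 by rewrite mulr_gt0// exprn_gt0//; case/andP: (Q0 c).
(* The left side of [gap] is positive, so the boxes are strictly smaller than the cells. *)
have aM : a < M^-1.
  have /andP[Qc Qm0] := Q0 [ffun=> ord0].
  rewrite -subr_gt0 -(pmulr_rgt0 _ c0_gt0) (lt_le_trans _ gap)//.
  by rewrite mulr_gt0// exprn_gt0// (lt_le_trans Qc).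
pose x c := sval (cid (pk c)).
have x01 c t i : 0 <= x c t ord0 i <= a / (r * Q c ^+ 2).
  by have [h _] := svalP (cid (pk c)); exact: h.
have x1 c t t' : t != t' -> 1 <= gen_norm s (x c t - x c t').
  by have [_ h] := svalP (cid (pk c)); exact: h.
(* The factor [r * Q c ^+ 2] turns distance [1] into [r * Q c ^+ 2] and the side of the packed box
   into [a]; the translation moves it to the corner of the cell. *)
pose F (t : {c & 'I_(k c)}) : 'rV[R]_p := \row_i ((tag t i)%:R / M +
  r * Q (tag t) ^+ 2 * x (tag t) (tagged t) ord0 i).
have FE (t : {c : {ffun 'I_p -> 'I_m.+1} & 'I_(k c)}) i :
       (tag t i)%:R / M <= F t ord0 i <= (tag t i)%:R / M + a.
  have /andP[h1 h2] := x01 (tag t) (tagged t) i.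
  by rewrite mxE lerDl lerD2l mulr_ge0 ?(ltW (rQ0 _))//= mulrC -ler_pdivlMr.
have Fitv (t : {c : {ffun 'I_p -> 'I_m.+1} & 'I_(k c)}) i :
      F t ord0 i \in axis_itv R (tag t i).
  have /andP[h1 h2] := FE t i; rewrite in_itv /= h1/= lteifS//.
  by rewrite (le_lt_trans h2)// -natr1 mulrDl mul1r ltrD2l.
have valF (t : {c : {ffun 'I_p -> 'I_m.+1} & 'I_(k c)}) :
      sval (to_cube (F t)) = F t.
  apply/rowP => i; rewrite -[LHS]/(coord (to_cube (F t)) i).
  by rewrite coord_to_cube// (axis_itv01 (Fitv t i)).
have cellF (t : {c : {ffun 'I_p -> 'I_m.+1} & 'I_(k c)}) :
      cell_index m (to_cube (F t)) = tag t.
  apply/ffunP => i; apply/eqP; rewrite ffunE axis_indexE ?coord_itv//.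
  by rewrite /coord valF.
have Fsep (t t' : {c : {ffun 'I_p -> 'I_m.+1} & 'I_(k c)}) : t != t' ->
    r * (q (to_cube (F t)) * q (to_cube (F t'))) <= gen_norm s (F t - F t').
  move=> tt'; have qF u : 0 <= q (to_cube (F u)) <= Q (tag u).
    by rewrite (ltW (q0 _)) -(cellF u) qQ.
  have /andP[q1 q1Q] := qF t; have /andP[q2 q2Q] := qF t'.
  (* Points of one cell inherit the scaled packing distance, and both charges are below [Q c]; for
     two cells, [gap] makes the comparison through the overall bound [Qm]. *)
  have [ctt'|/eqP ctt'] := pselect (tag t = tag t').
    case: t t' tt' ctt' {q1 q2} q1Q q2Q => [c t] [c' t'] /= tt' cc'; subst c'.
    have {}tt' : t != t' by apply: contraNneq tt' => ->.
    move=> q1 q2; have -> : F (existT _ c t) - F (existT _ c t') =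
        (r * Q c ^+ 2) *: (x c t - x c t').
      by apply/rowP => i; rewrite !mxE /=; ring.
    rewrite gen_normZ ?(ltW (rQ0 c))// -[leLHS]mulr1.
    apply: ler_pM; rewrite ?x1//; first by rewrite mulr_ge0 ?mulr_ge0 ?ltW.
    by rewrite ler_pM2l// expr2 ler_pM// ltW.
  have [i cti] : exists i, tag t i != tag t' i.
    apply/existsP; apply: contra_neqT ctt'; rewrite negb_exists => /forallP h.
    by apply/ffunP => i; apply/eqP; rewrite -[_ == _]negbK.
  apply: le_trans (gen_norm_ge s0 _ i).
  apply: (@le_trans _ _ (r * Qm ^+ 2)).
    by rewrite ler_pM2l// expr2 ler_pM// (le_trans q1Q, le_trans q2Q)//;
      case/andP: (Q0 (tag t)); case/andP: (Q0 (tag t')).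
  apply: le_trans gap _; rewrite ler_pM2l// [leRHS](_ : _ = `|F t ord0 i - F t' ord0 i|).
    have apart (u u' : {c : {ffun 'I_p -> 'I_m.+1} & 'I_(k c)}) :
        (tag u i < tag u' i)%N ->
        M^-1 - a <= F u' ord0 i - F u ord0 i.
      move=> uu'; have /andP[_ h1] := FE u i; have /andP[h2 _] := FE u' i.
      have h3 : (tag u i)%:R / M + M^-1 <= (tag u' i)%:R / M.
        by rewrite -[X in _ + X]mul1r -mulrDl ler_pM2r ?invr_gt0// natr1 ler_nat.
      have -> : M^-1 - a = (tag u i)%:R / M + M^-1 - ((tag u i)%:R / M + a).
        by rewrite opprD addrACA subrr add0r.
      exact: lerB (le_trans h3 h2) h1.
    by case: (ltngtP (tag t i) (tag t' i)) cti => [/apart|/apart|/val_inj->];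
      rewrite ?eqxx// => h _; [rewrite distrC|]; exact: le_trans h (ler_norm _).
  by rewrite [in RHS]/F !mxE.
(* Equal images would be at distance [0], while [Fsep] gives distinct indices a positive
   distance. *)
have F_inj : injective (fun t => to_cube (F t)).
  move=> t t' /(congr1 sval); rewrite !valF.
  move=> FF; apply/eqP; apply/negPn/negP => /Fsep; rewrite FF subrr.
  rewrite -[0](scale0r (0 : 'rV[R]_p)) gen_normZ// mul0r leNgt.
  by rewrite mulr_gt0// mulr_gt0.
pose L := map (fun t => to_cube (F t)) (enum {: {c & 'I_(k c)}}).
have uL : uniq L by rewrite map_inj_uniq// enum_uniq.
have sL : size L = (\sum_c k c)%N.
  rewrite size_map -cardE card_tagged sumnE big_map -[in RHS]big_enum/=.
  by apply: eq_bigr => c _; rewrite card_ord.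
(* Any [n] of the points will do, as separation passes to subsets. *)
exists [fset z in take n L]%fset.
  by rewrite card_fseq undup_id ?take_uniq// size_takel ?sL.
move=> y z; rewrite !inE => /mem_take/mapP[t _ ->] /mem_take/mapP[t' _ ->] yz.
rewrite /charged_dist gen_distE ler_pdivlMr ?mulr_gt0// !valF; apply: Fsep.
by apply: contraNneq yz => ->.
Qed.

End separated.

(** * Densities and empirical means *)

Section density.
Context d (T : measurableType d) (R : realType).
Context (mu : {measure set T -> \bar R}) (f : T -> \bar R).
Hypotheses (mf : measurable_fun setT f) (f0 : forall x, (0 <= f x)%E).
Hypothesis f1 : (\int[mu]_x f x = 1)%E.

Definition with_density (A : set T) : \bar R := (\int[mu]_(x in A) f x)%E.

Let with_density0 : with_density set0 = 0%E.
Proof. exact: integral_set0. Qed.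

Let with_density_ge0 A : (0 <= with_density A)%E.
Proof. exact: integral_ge0. Qed.

HB.instance Definition _ := isMeasure.Build _ _ _ with_density
  with_density0 with_density_ge0 (semi_sigma_additive_nng_induced mf f0).

HB.instance Definition _ :=
  @Measure_isProbability.Build _ _ R with_density f1.

Lemma exists_probability_density : exists P : probability T R,
  forall A, P A = (\int[mu]_(x in A) f x)%E.
Proof. by exists with_density. Qed.

End density.

(** The empirical measure is a scaled finite sum of Dirac masses. The formula is first obtained for
    nonnegative functions, then applied to the positive and negative parts of [g]. *)
Lemma integral_empirical d (T : measurableType d) (R : realType) (D : {fset T})
    (g : T -> R) : measurable_fun setT g ->
  (\int[empirical R D]_x (g x)%:E)%E = ((\sum_(x <- D) g x) / #|` D|%:R)%:E.
Proof.
move=> mg.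
have empE (A : set T) : empirical R D A =
    mscale ((#|` D|)%:R^-1)%:nng (msum (fun k => \d_(nth point D k)) #|` D|) A.
  transitivity (((#|` D|)%:R^-1)%:E * \sum_(x <- D) (\d_x A : \bar R))%E.
    rewrite /empirical; under eq_bigr do rewrite diracE.
    rewrite sumEFin -EFinM mulrC; congr (_ * _)%:E.
    rewrite -natr_sum card_fset_sum1 -(big_fset_condE _ _ (fun x => x \in A)).
    by rewrite big_mkcond /=; congr _%:R; apply: eq_bigr => x _; case: (x \in A).
  by congr (_ * _)%E; rewrite (big_nth point) big_mkord.
have ge0E (f : T -> R) : measurable_fun setT f -> (forall x, 0 <= f x) ->
    (\int[empirical R D]_x (f x)%:E = (#|` D|%:R^-1 * \sum_(x <- D) f x)%:E)%E.
  move=> mf f0; have mEf : measurable_fun setT (fun x => (f x)%:E).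
    exact/measurable_EFinP.
  rewrite (eq_measure_integral _ (fun A _ _ => empE A)).
  rewrite ge0_integral_mscale//=; last by move=> x _; rewrite lee_fin.
  rewrite ge0_integral_measure_sum//; last by move=> x _; rewrite lee_fin.
  rewrite EFinM -sumEFin.
  congr (_ * _)%E; rewrite (big_nth point) big_mkord; apply: eq_bigr => i _.
  by rewrite integral_dirac// diracT mul1e.
rewrite integralE.
under eq_integral do rewrite funeposE -EFin_max.
under [X in (_ - X)%E]eq_integral do rewrite funenegE -EFinN -EFin_max.
rewrite !ge0E; last 4 first.
- by apply: measurable_maxr => //; exact: measurableT_comp.
- by move=> x; rewrite le_max lexx orbT.
- by apply: measurable_maxr.
- by move=> x; rewrite le_max lexx orbT.
rewrite -EFinB -mulrBr -sumrB mulrC; congr (_ * _)%:E; apply: eq_bigr => x _.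
by case: (leP (g x) 0) => gx; case: (leP (- g x) 0) => gx'; lra.
Qed.

Section integrals.
Context (R : realType) (p : nat).
Implicit Types g w : cube R p -> R.

(** The grid with [m = 0] has a single cell, the whole cube. *)
Lemma lebesgue_cubeT : lebesgue_cube [set: borel (cube R p)] = 1%E :> \bar R.
Proof.
rewrite (measure_cells 0).
transitivity (\sum_(c : {ffun 'I_p -> 'I_1}) 1%:E : \bar R)%E.
  apply: eq_bigr => c _; apply: etrans (lebesgue_cube_cell R c) _.
  by rewrite invr1 expr1n.
by rewrite sumEFin sumr_const card_ffun !card_ord exp1n.
Qed.

Lemma continuous_scale g (k : R) : continuous g -> continuous (fun x => k * g x).
Proof.
by move=> cg x; apply: continuous_comp (cg x) _; exact: mulrl_continuous.
Qed.

Lemma continuous_addr g (k : R) : continuous g -> continuous (fun x => g x + k).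
Proof.
move=> cg x; apply: (continuous_comp (g := fun y => y + k) (cg x)).
by apply: cvgD; [exact: cvg_id|exact: cvg_cst].
Qed.

Lemma measurable_EFin_continuous g : continuous g ->
  measurable_fun [set: borel (cube R p)] (fun x => (g x)%:E).
Proof. by move=> cg; apply/measurable_EFinP; exact: measurable_fun_continuous. Qed.

Lemma integrable_continuous (P : probability (borel (cube R p)) R) g :
  continuous g -> P.-integrable [set: borel (cube R p)] (fun x => (g x)%:E).
Proof.
move=> cg; apply: measurable_bounded_integrable => //.
  by rewrite ltey_eq fin_num_measure.
  exact: measurable_fun_continuous.
have [M gM] := cube_bounded cg.
exists M; split; first exact: num_real.
by move=> y My z _; exact: le_trans (gM z) (ltW My).
Qed.

(** The normalizing integral lies between the minimum and the maximum of [w], hence is finite and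
    positive. *)
Lemma exists_density w : continuous w -> (forall x, 0 < w x) ->
  exists (P : probability (borel (cube R p)) R) (k : R), 0 < k /\
    forall A : set (borel (cube R p)), measurable A ->
      P A = (\int[@lebesgue_cube R p]_(x in A) (k * w x)%:E)%E.
Proof.
move=> cw w0.
have [x1 x1w] := cube_min cw; have [x2 x2w] := cube_max cw.
have mw := measurable_EFin_continuous cw.
set Z := (\int[@lebesgue_cube R p]_x (w x)%:E)%E.
have Zlo : ((w x1)%:E <= Z)%E.
  rewrite -[leLHS]mule1 -lebesgue_cubeT -integral_cst//.
  apply: ge0_le_integral => //= x _; rewrite lee_fin ?x1w//; exact: ltW.
have Zhi : (Z <= (w x2)%:E)%E.
  rewrite -[leRHS]mule1 -lebesgue_cubeT -integral_cst//.
  apply: ge0_le_integral => //= x _; rewrite lee_fin ?x2w//; exact: ltW.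
have [z Zz z0] : exists2 z : R, Z = z%:E & 0 < z.
  move: Zlo Zhi; case: Z => // z; rewrite lee_fin => xz _.
  by exists z => //; exact: lt_le_trans xz.
have mzw : measurable_fun [set: borel (cube R p)] (fun x => (z^-1 * w x)%:E).
  apply: (@measurable_EFin_continuous (fun x => z^-1 * w x)).
  exact: continuous_scale.
have zw0 x : (0 <= (z^-1 * w x)%:E)%E by rewrite lee_fin mulr_ge0// ?invr_ge0 ltW.
have zw1 : (\int[@lebesgue_cube R p]_x (z^-1 * w x)%:E = 1)%E.
  under eq_integral do rewrite EFinM.
  rewrite ge0_integralZl ?lee_fin ?invr_ge0 ?(ltW z0)//.
    by rewrite -/Z Zz -EFinM mulVf// gt_eqF.
  by move=> x _; rewrite lee_fin ltW.
have [P PE] := exists_probability_density mzw zw0 zw1.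
by exists P, z^-1; rewrite invr_gt0; split.
Qed.

Lemma density_cell_bounds m (P : probability (borel (cube R p)) R) w (k lo hi : R)
    (c : {ffun 'I_p -> 'I_m.+1}) :
  continuous w -> 0 < k ->
  (forall A : set (borel (cube R p)), measurable A ->
    P A = (\int[@lebesgue_cube R p]_(x in A) (k * w x)%:E)%E) ->
  0 <= lo -> (forall x, cell_index m x = c -> lo <= w x <= hi) ->
  k * lo * m.+1%:R^-1 ^+ p <= fine (P (cell c)) <= k * hi * m.+1%:R^-1 ^+ p.
Proof.
move=> cw k0 PE lo0 cellw; have mc := @measurable_cell R p m c.
have Pfin : P (cell c) \is a fin_num by rewrite fin_num_measure.
have mkw : measurable_fun (cell c) (fun x : borel (cube R p) => (k * w x)%:E).
  apply: measurable_funTS; apply: (@measurable_EFin_continuous (fun x => k * w x)).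
  exact: continuous_scale.
have intc (a : R) : (\int[@lebesgue_cube R p]_(x in cell c) (k * a)%:E =
    (k * a * m.+1%:R^-1 ^+ p)%:E)%E.
  by rewrite integral_cst// [RHS]EFinM; congr (_ * _)%E; exact: lebesgue_cube_cell.
rewrite -!lee_fin fineK// PE// -!intc; apply/andP; split.
  apply: ge0_le_integral => //= x xc; rewrite lee_fin.
    by rewrite mulr_ge0// ltW.
  by rewrite ler_pM2l//; have /andP[] := cellw _ xc.
apply: ge0_le_integral => //= x xc; have /andP[h1 h2] := cellw _ xc.
  by rewrite lee_fin mulr_ge0 ?(ltW k0)// (le_trans lo0).
by rewrite lee_fin ler_pM2l.
Qed.

(** The left side is the integral of the step function equal on each cell to the corner value of
    [g], which lies below [g + e]. *)
Lemma Rintegral_cells_le m (P : probability (borel (cube R p)) R) g (e : R) :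
  continuous g -> (forall x, 0 <= g x) -> 0 <= e ->
  (forall x, g (corner R (cell_index m x)) <= g x + e) ->
  \sum_c g (corner R c) * fine (P (@cell R p m c)) <= Rintegral P setT g + e.
Proof.
move=> cg g0 e0 ge; have intg := integrable_continuous P cg.
have -> : Rintegral P setT g + e = Rintegral P setT (fun x => g x + e).
  rewrite RintegralD//; last exact: integrable_continuous (@cst_continuous _ _ e).
  rewrite Rintegral_cst// [fine _](_ : _ = 1) ?mulr1//.
  exact: (congr1 fine (probability_setT P)).
have cge : continuous (fun x => g x + e) by exact: continuous_addr.
have mge := measurable_EFin_continuous cge.
rewrite -lee_fin fineK; last exact: integrable_fin_num (integrable_continuous P cge).
rewrite (ge0_integral_cells m P mge) => [|x]; last by rewrite lee_fin addr_ge0.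
rewrite -sumEFin; apply: lee_sum => c _; have mc := @measurable_cell R p m c.
have Pfin : P (cell c) \is a fin_num by rewrite fin_num_measure.
rewrite EFinM fineK// -integral_cst//.
apply: ge0_le_integral => //=; first by move=> x _; rewrite lee_fin.
  exact: measurable_funTS.
by move=> x <-; rewrite lee_fin.
Qed.

End integrals.

(** * Convergence of the designs *)

Lemma lipschitz_continuous (R : realType) (p : nat) (q : cube R p -> R) (L : R) :
  0 < L -> (forall u v, `|q u - q v| <= L * euclidean_dist u v) -> continuous q.
Proof.
move=> L0 qL x A /nbhs_ballP[e /= e0 eA].
(* Taking [p.+1] instead of [p] keeps the divisor positive and makes the final comparison strict. *)
pose d := e / (L * Num.sqrt p.+1%:R).
have Lp0 : 0 < L * Num.sqrt p.+1%:R by rewrite mulr_gt0// sqrtr_gt0 ltr0n.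
have d0 : 0 < d by rewrite divr_gt0.
have := coord_cvg x d0; apply: (@filterS _ _ (@nbhs_filter (cube R p) x)) => y xy.
apply: eA; apply: le_lt_trans (qL x y) _.
suff : euclidean_dist x y < Num.sqrt p.+1%:R * d.
  rewrite -(ltr_pM2l L0) => /lt_le_trans; apply.
  by rewrite mulrA /d mulrC divfK// gt_eqF.
rewrite -[X in _ * X](ger0_norm (ltW d0)) -sqrtr_sqr -sqrtrM ?ler0n//.
rewrite ltr_sqrt; last exact: mulr_gt0 (ltr0Sn _ _) (exprn_gt0 _ d0).
apply: (@le_lt_trans _ _ (\sum_(l < p) d ^+ 2)).
  apply: ler_sum => l _; rewrite -[leLHS]real_normK ?num_real//.
  by rewrite lerXn2r ?nnegrE ?normr_ge0 ?(ltW d0) ?(ltW (xy l)).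
by rewrite sumr_const card_ord -[_ *+ p]mulr_natl ltr_pM2r ?exprn_gt0// ltr_nat.
Qed.

Section limit.
Context (R : realType) (p : nat) (q : cube R p -> R).
Hypotheses (p0 : (0 < p)%N) (q0 : forall x, 0 < q x) (cq : continuous q).
Context (P : probability (borel (cube R p)) R) (k : R).
Hypothesis k0 : 0 < k.
Hypothesis PE : forall A : set (borel (cube R p)), measurable A ->
  P A = (\int[@lebesgue_cube R p]_(x in A) (k * (q x ^+ (2 * p))^-1)%:E)%E.
Context (s : R) (D : nat -> {fset cube R p}).
Hypothesis s0 : 0 < s.
Hypothesis medD : forall n, (2 <= n)%N -> is_med q s n (D n).

Definition cell_count m n (c : {ffun 'I_p -> 'I_m.+1}) : nat :=
  #|[set x : D n | cell_index m (val x) == c]%SET|.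

Lemma card_D n : (2 <= n)%N -> #|` D n| = n.
Proof. by move=> /medD[]. Qed.

Lemma med_value n : (2 <= n)%N -> exists psi : R, [/\ 0 < psi,
  charge_separated q s psi (D n) & forall r (D' : {fset cube R p}),
    #|` D'| = n -> charge_separated q s r D' -> r <= psi].
Proof.
move=> n2; have [Dn maxD] := medD n2.
have [|psi psi0 psiE] := med_criterion_fin p0 s0 q0 (D := D n); first by rewrite Dn.
exists psi; split=> //; first by apply/separatedP; rewrite psiE.
by move=> r D' /maxD; rewrite psiE -lee_fin => /[swap] /separatedP; exact: le_trans.
Qed.

(** On the grid with one cell, a design separated by [e] is a packing of a box that does not depend
    on [n], so its cardinal is bounded. *)
Lemma med_value_cvg0 (e : R) : 0 < e ->
  \forall n \near \oo, (2 <= n)%N /\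
    forall psi, charge_separated q s psi (D n) -> psi < e.
Proof.
move=> e0; have [x1 x1q] := cube_min cq.
have [N packN] := packing_bounded (@gen_normZ R p s s0) (gen_norm_le p0 s0)
  (1%:R^-1 / (e * q x1 ^+ 2)).
exists (maxn 2 N.+1) => // n /=; rewrite geq_max => /andP[n2 Nn]; split=> // psi sepD.
rewrite ltNge; apply/negP => epsi; move: Nn; rewrite ltnNge => /negP; apply.
have sepe : charge_separated q s e (D n).
  by move=> x y xD yD xy; exact: le_trans (sepD x y xD yD xy).
have qx1 x : cell_index 0 x = [ffun=> ord0] -> q x1 <= q x.
  by move=> _; exact: x1q.
have := packN _ (packing_of_separated s0 q0 e0 (q0 x1) sepe qx1).
apply: leq_trans; rewrite -[leqLHS](card_D n2) cardfE -cardsT; apply: subset_leq_card.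
by apply/fintype.subsetP => x _; rewrite inE; apply/eqP/ffunP => i; rewrite [LHS]ord1 ffunE.
Qed.

Lemma continuous_weight : continuous (fun x => (q x ^+ (2 * p))^-1).
Proof.
move=> x; have cV : {for q x, continuous (fun y : R => (y ^+ (2 * p))^-1)}.
  apply: cvgV; first by rewrite expf_neq0// gt_eqF.
  exact: exprn_continuous.
exact: (continuous_comp (@cq x) cV).
Qed.

(** An upper bound on the count in one cell ([hi]) is multiplied by a lower bound on the optimal
    value ([lo]); [Delta] and [psi] cancel, and neither needs to be known. *)
Lemma cell_count_le m (a : R) : 0 < a ->
  (forall x, q x <= (1 + a) * q (corner R (cell_index m x))) ->
  (forall x, q (corner R (cell_index m x)) <= (1 + a) * q x) ->
  \forall n \near \oo, forall c : {ffun 'I_p -> 'I_m.+1},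
    (cell_count n c)%:R <= (1 + a) ^+ (10 * p).+1 * fine (P (cell c)) * n%:R.
Proof.
(* Every approximation below costs a power of the factor [b], kept opaque for the algebra. *)
have [b bE] : exists b, b = 1 + a by exists (1 + a).
rewrite -bE => a0 qhi qlo.
have b1 : 1 < b by rewrite bE ltrDl.
have b0 : 0 < b by exact: lt_trans b1.
have [M ME] : exists M : R, M = m.+1%:R by exists m.+1%:R.
have Mpos : 0 < M by rewrite ME ltr0n.
have M0 : 0 < M^-1 by rewrite ME invr_gt0 ltr0n.
pose c0 : R := p%:R^-1 `^ s^-1.
have c00 : 0 < c0 by rewrite powR_gt0// invr_gt0 ltr0n.
have [Delta Delta0 [packlo packhi]] :=
  packing_density c00 (@gen_normZ R p s s0) (gen_norm_ge s0) (gen_norm_le p0 s0).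
have [T0 T00 {}packhi] := packhi a a0; rewrite -bE in packhi.
have [x2 x2q] := cube_max cq.
pose qc (c : {ffun 'I_p -> 'I_m.+1}) := q (corner R c : cube R p).
have qc0 c' : 0 < qc c' by exact: q0.
pose Qm := b * q x2; have Qm0 : 0 < Qm by rewrite mulr_gt0.
have qcQ c : b * qc c <= Qm by rewrite ler_pM2l// x2q.
(* For [psi] below the first bound, rescaled cells have side at least [T0], as [packhi] requires;
   below the second, the shrunken cells meet the gap condition of [exists_separated]. *)
pose e1 := Num.min (M^-1 / (Qm ^+ 2 * T0)) (c0 * (M^-1 - M^-1 / b) / (b * Qm ^+ 2)).
have Mb : 0 < M^-1 - M^-1 / b.
  by rewrite subr_gt0 ltr_pdivrMr// ltr_pMr.
have e10 : 0 < e1.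
  by rewrite lt_min !divr_gt0 ?mulr_gt0 ?exprn_gt0.
have := med_value_cvg0 e10; apply: filterS => n [n2 psie1] c.
have [psi [psi0 sepD maxD]] := med_value n2.
have {}psie1 := psie1 _ sepD.
(* Up to powers of [b], [u c / psi] is the side of the rescaled cell, and [k * v c] is its mass
   under [P]. *)
pose u c := M^-1 / qc c ^+ 2.
have u0 c' : 0 < u c' by rewrite divr_gt0// exprn_gt0// q0.
pose v c := u c ^+ p.
have v0 c' : 0 < v c' by rewrite exprn_gt0.
have hi : (cell_count n c)%:R * psi ^+ p <= Delta * (b * b ^+ (2 * p) * v c).
  have cellq x : cell_index m x = c -> qc c / b <= q x.
    by move=> <-; rewrite ler_pdivrMr// mulrC qlo.
  have qcb0 : 0 < qc c / b by rewrite divr_gt0// q0.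
  have := packing_of_separated s0 q0 psi0 qcb0 sepD cellq.
  rewrite -ME (_ : _ / _ = b ^+ 2 * u c / psi); last first.
    by rewrite /u; field; rewrite !gt_eqF//.
  move=> /packhi; rewrite -ler_pdivlMr ?exprn_gt0// => /(_ _)/le_trans; apply.
    have h : psi * (Qm ^+ 2 * T0) <= M^-1.
      rewrite -ler_pdivlMr ?mulr_gt0 ?exprn_gt0// ltW//.
      by apply: lt_le_trans psie1 _; rewrite ge_min lexx.
    rewrite ler_pdivlMr// /u mulrA ler_pdivlMr ?exprn_gt0//.
    apply: (@le_trans _ _ (psi * (Qm ^+ 2 * T0))).
      rewrite (_ : T0 * psi * _ = psi * (qc c ^+ 2 * T0)); last by ring.
      rewrite ler_pM2l// ler_pM2r// lerXn2r ?nnegrE ?(ltW (qc0 c)) ?(ltW Qm0)//.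
      by apply: le_trans (qcQ c); rewrite ler_peMl ?(ltW (qc0 c)) ?ltW.
    by apply: le_trans h _; rewrite ler_peMl ?(ltW M0)// exprn_ege1// ltW.
  rewrite expr_div_n exprMn -exprM -/(v c) le_eqVlt; apply/orP; left.
  by apply/eqP; ring.
have lo : Delta * (\sum_c v c) <= (b ^+ (2 * p)) ^+ 2 * psi ^+ p * n%:R.
  (* The side carries four factors [b^-1]: one for the shrunken box, one for the target [b * psi],
     two for the squared charge bound. *)
  have T'0 c' : 0 < M^-1 / b / (b * psi * (b * qc c') ^+ 2).
    by rewrite !(divr_gt0, mulr_gt0, exprn_gt0)// q0.
  have [kc kcP] := choice (fun c' => let: ex_intro2 k h1 h2 := packlo _ (T'0 c') in
    ex_intro (fun k => packing _ _ k /\ _ <= k%:R) k (conj h1 h2)).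
  (* Otherwise these packings would make an [n]-point design with criterion at
     least [b * psi > psi]. *)
  have kcn : (\sum_c kc c < n)%N.
    rewrite ltnNge; apply/negP => nkc.
    have [||||||D' D'n sepD'] := @exists_separated R p q s p0 s0 q0 m (b * psi)
      (M^-1 / b) Qm (fun c => b * qc c) kc n _ _ _ _ _ _ nkc.
    - exact: mulr_gt0.
    - by rewrite divr_ge0// ltW.
    - rewrite -ME -/c0 mulrAC mulrC -ler_pdivlMr ?mulr_gt0 ?exprn_gt0//.
      by rewrite ltW// (lt_le_trans psie1)// ge_min lexx orbT.
    - by move=> c'; rewrite qcQ mulr_gt0// q0.
    - exact: qhi.
    - by move=> c'; have [] := kcP c'.
    by have := maxD _ _ D'n sepD'; rewrite leNgt ltr_pMl// b1.
  apply: (@le_trans _ _ ((b ^+ (2 * p)) ^+ 2 * psi ^+ p * (\sum_c kc c)%:R)); last first.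
    by rewrite ler_pM2l ?mulr_gt0 ?exprn_gt0// ler_nat ltnW.
  rewrite natr_sum !mulr_sumr; apply: ler_sum => c' _.
  have [_ kcc] := kcP c'.
  have B0 : 0 <= (b ^+ (2 * p)) ^+ 2 * psi ^+ p by rewrite ltW// mulr_gt0 ?exprn_gt0.
  apply: le_trans (ler_wpM2l B0 kcc); rewrite le_eqVlt; apply/orP; left; apply/eqP.
  rewrite (_ : M^-1 / b / (b * psi * (b * qc c') ^+ 2) = u c' / (b ^+ 2 * b ^+ 2 * psi)); last first.
    by rewrite /u; field; rewrite !gt_eqF//.
  rewrite expr_div_n -/(v c') [(_ * psi) ^+ p]exprMn [(b ^+ 2 * _) ^+ p]exprMn.
  rewrite -(exprM b 2 p); field.
  by rewrite !expf_neq0// gt_eqF.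
have Pcell c' : k * (b ^+ (2 * p))^-1 * v c' <= fine (P (cell c')) <=
    k * b ^+ (2 * p) * v c'.
  have vE : v c' = (qc c' ^+ (2 * p))^-1 * m.+1%:R^-1 ^+ p.
    by rewrite /v /u expr_div_n -ME mulrC -exprM.
  suff : k * ((b ^+ (2 * p))^-1 * (qc c' ^+ (2 * p))^-1) * m.+1%:R^-1 ^+ p <=
      fine (P (cell c')) <=
      k * (b ^+ (2 * p) * (qc c' ^+ (2 * p))^-1) * m.+1%:R^-1 ^+ p.
    by rewrite vE !mulrA.
  apply: (density_cell_bounds continuous_weight k0 PE) => [|x xc'].
    by rewrite mulr_ge0 ?invr_ge0 ?exprn_ge0 ?ltW.
  have qx0 := q0 x; have := qhi x; have := qlo x; rewrite xc' -/(qc c') => qx1 qx2.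
  rewrite -invfM -exprMn ler_pV2 ?inE ?unitfE ?expf_neq0 ?exprn_gt0 ?gt_eqF ?mulr_gt0//.
  rewrite lerXn2r ?nnegrE ?(ltW qx0) ?(ltW (mulr_gt0 b0 _))//=.
  rewrite ler_pdivlMr ?exprn_gt0// mulrC ler_pdivrMr ?exprn_gt0//.
  by rewrite -exprMn lerXn2r ?nnegrE ?(ltW (qc0 c')) ?(ltW (mulr_gt0 b0 _)).
(* The cell masses sum to one, which bounds [k] from below in terms of the [v c]. *)
have Phi : 1 <= k * b ^+ (2 * p) * \sum_c v c.
  rewrite -lee_fin mulr_sumr -sumEFin -(probability_setT P) (measure_cells m P).
  apply: lee_sum => c' _; have /andP[_ Pc'] := Pcell c'.
  have Pfin : P (cell c') \is a fin_num.
    by rewrite fin_num_measure//; exact: measurable_cell.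
  by move: Pc'; rewrite -lee_fin (fineK Pfin).
have {Pcell}Plo : k * v c <= b ^+ (2 * p) * fine (P (cell c)).
  have /andP[+ _] := Pcell c.
  by rewrite mulrAC -ler_pdivlMr ?invr_gt0 ?exprn_gt0// invrK [leRHS]mulrC.
(* The single [b] comes from [packhi]. Of the five factors [b ^+ (2 * p)], one comes from [hi], two
   from [lo], one from [Phi] and one from [Plo]. *)
have -> : b ^+ (10 * p).+1 = b * (b ^+ (2 * p)) ^+ 5.
  by rewrite exprS -exprM mulnAC.
move: (b ^+ (2 * p)) (exprn_gt0 (2 * p) b0) (psi ^+ p) (exprn_gt0 p psi0)
  (fine (P (cell c))) (\sum_c v c) hi lo Plo Phi => B B0 X X0 Pc S hi lo Plo Phi.
move: {Plo}(v c) hi Plo => vc hi Plo; move: (cell_count n c)%:R (ler0n R (cell_count n c)) hi.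
move=> C C0 hi; have n0 : 0 <= n%:R :> R by [].
(* Apply [lo] and then [hi], which absorbs [X]; the factor [Delta] is common to both sides. *)
have CS : C * S <= b * B ^+ 3 * vc * n%:R.
  rewrite -(ler_pM2l Delta0).
  apply: (@le_trans _ _ (C * (B ^+ 2 * X * n%:R))).
    by rewrite mulrCA ler_wpM2l.
  rewrite (_ : C * _ = B ^+ 2 * n%:R * (C * X)); last by ring.
  rewrite (_ : Delta * _ = B ^+ 2 * n%:R * (Delta * (b * B * vc))); last by ring.
  by rewrite ler_wpM2l// mulr_ge0// exprn_ge0// ltW.
apply: (@le_trans _ _ (C * (k * B * S))); first by rewrite ler_peMr.
rewrite (_ : C * _ = k * B * (C * S)); last by ring.
apply: le_trans (ler_wpM2l (ltW (mulr_gt0 k0 B0)) CS) _.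
rewrite (_ : k * B * _ = b * B ^+ 4 * n%:R * (k * vc)); last by ring.
rewrite (_ : b * B ^+ 5 * Pc * n%:R = b * B ^+ 4 * n%:R * (B * Pc)); last by ring.
by rewrite ler_wpM2l// !mulr_ge0// ?exprn_ge0 ?ltW.
Qed.

Lemma mean_le (g : cube R p -> R) (e : R) : continuous g -> 0 < e ->
  \forall n \near \oo,
    (\sum_(x <- D n) g x) / #|` D n|%:R <= Rintegral P setT g + e.
Proof.
move=> cg e0; have [x1 x1q] := cube_min cq; have [B gB] := cube_bounded cg.
(* The counts are bounded only from above, so they can be weighted only by nonnegative values; hence
   the shift by [B]. *)
pose h x := g x + B.
have ch : continuous h by exact: continuous_addr.
have h0 x : 0 <= h x.
  by rewrite -lerBlDr sub0r lerNl (le_trans (ler_norm _))// normrN.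
pose Ih := Rintegral P setT h.
have IhE : Ih = Rintegral P setT g + B.
  rewrite /Ih RintegralD//; last 2 first.
  - exact: integrable_continuous.
  - exact: integrable_continuous (@cst_continuous _ _ B).
  rewrite Rintegral_cst// [fine _](_ : _ = 1) ?mulr1//.
  exact: (congr1 fine (probability_setT P)).
(* The relative error [e2] on the counts costs at most [e / 4]. Passing to corner values adds
   [e3 = e / 8] for the mean and again for the integral, there multiplied by [1 + e2 <= 2]. *)
pose e2 := Num.min 1 (e / (4 * (`|Ih| + 1))).
have I1 : 0 < `|Ih| + 1 by rewrite ltr_wpDl.
have e20 : 0 < e2 by rewrite lt_min ltr01 divr_gt0// mulr_gt0.
have e21 : e2 <= 1 by rewrite ge_min lexx.
have e2I : e2 * Ih <= e / 4.
  apply: (@le_trans _ _ (e2 * (`|Ih| + 1))).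
    by rewrite ler_pM2l// (le_trans (ler_norm _))// lerDl.
  by rewrite -ler_pdivlMr// -mulrA -invfM ge_min lexx orbT.
have [a /andP[a0 _] ae] := exists_expr1D_le (10 * p).+1 e20.
pose e3 := e / 8; have e30 : 0 < e3 by rewrite divr_gt0.
(* On this grid [q] differs from its corner value by less than [a] times its minimum, so the
   additive error becomes a factor [1 + a]. *)
have [m [hq hh]] := filter_ex (filterI
  (near_corner cq (mulr_gt0 a0 (q0 x1))) (near_corner ch e30)).
have qmin x : a * q x1 <= a * q x by rewrite ler_pM2l// x1q.
have qhi x : q x <= (1 + a) * q (corner R (cell_index m x)).
  have := hq x; have := qmin (corner R (cell_index m x)).
  by rewrite ltr_distl => ? /andP[_ ?]; lra.
have qlo x : q (corner R (cell_index m x)) <= (1 + a) * q x.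
  have := hq x; have := qmin x.
  by rewrite ltr_distl => ? /andP[? _]; lra.
have cells : \sum_c h (corner R c) * fine (P (@cell R p m c)) <= Ih + e3.
  apply: Rintegral_cells_le => //; first exact: ltW.
  by move=> x; have := hh x; rewrite ltr_distl => /andP[? _]; lra.
have n2 : \forall n \near \oo, (2 <= n)%N by exists 2%N.
apply: filterS2 (cell_count_le a0 qhi qlo) n2 => n count {}n2.
have n0 : 0 < n%:R :> R by rewrite ltr0n ltnW.
rewrite (card_D n2) ler_pdivrMr//.
have -> : \sum_(x <- D n) g x = \sum_(x : D n) h (val x) - n%:R * B.
  rewrite big_split/= sumr_const -cardfE (card_D n2) mulr_natl addrK.
  by rewrite (big_seq_fsetE _ _ xpredT).
have -> : Rintegral P setT g = Ih - B by rewrite IhE addrK.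
suff : \sum_(x : D n) h (val x) <= n%:R * (Ih + e) by lra.
apply: (@le_trans _ _ (\sum_(x : D n) (h (corner R (cell_index m (val x))) + e3))).
  by apply: ler_sum => x _; have := hh (val x); rewrite ltr_distl => /andP[_ ?]; lra.
rewrite big_split/= sumr_const -cardfE (card_D n2) -[_ *+ n]mulr_natl.
have -> : \sum_(x : D n) h (corner R (cell_index m (val x))) =
    \sum_(c : {ffun 'I_p -> 'I_m.+1}) (cell_count n c)%:R * h (corner R c).
  rewrite (partition_big (fun x : D n => cell_index m (val x)) xpredT)//=.
  apply: eq_bigr => c _; rewrite mulr_natl -sumr_const.
  by apply: eq_big => [x|x /eqP ->//]; rewrite inE.
have cnt : \sum_(c : {ffun 'I_p -> 'I_m.+1}) (cell_count n c)%:R * h (corner R c) <=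
    n%:R * ((1 + e2) * (Ih + e3)).
  apply: (@le_trans _ _ (n%:R * ((1 + e2) *
      \sum_c h (corner R c) * fine (P (@cell R p m c))))); last first.
    by rewrite !ler_pM2l// addr_gt0.
  rewrite !mulr_sumr; apply: ler_sum => c _.
  apply: le_trans (ler_wpM2r (h0 _) (count c)) _.
  rewrite (_ : n%:R * _ = (1 + e2) * fine (P (cell c)) * n%:R * h (corner R c)).
    rewrite !ler_wpM2r// ?ler0n// fine_ge0//.
  by ring.
have : n%:R * ((1 + e2) * (Ih + e3)) + n%:R * e3 <= n%:R * (Ih + e).
  rewrite -mulrDr ler_pM2l// /e3.
  have : e2 * (e / 8) <= e / 8 by rewrite ler_piMl// ltW.
  by lra.
by apply: le_trans; rewrite lerD2r.
Qed.

End limit.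

Theorem theorem1 (R : realType) (p : nat) (hp : (1 <= p)%N)
  (q : cube R p -> R) (hq0 : forall x, 0 < q x)
  (hqL : exists L : R, 0 < L /\
    forall u v, `|q u - q v| <= L * euclidean_dist u v)
  (D : R -> nat -> {fset cube R p})
  (hD : forall (s : R) (n : nat), 0 < s -> (2 <= n)%N ->
    is_min_index_med q s n (D s n)) :
  exists P : probability (borel (cube R p)) R,
    (forall s : R, 0 < s ->
      weak_cvg (fun n => empirical R (D s n : {fset borel (cube R p)})) P) /\
    (exists c : R, 0 < c /\
      forall A : set (borel (cube R p)), measurable A ->
        P A = (\int[@lebesgue_cube R p]_(x in A) (c / q x ^+ (2 * p))%:E)%E).
Proof.
have [L [L0 qL]] := hqL; have cq := lipschitz_continuous L0 qL.
have w0 x : 0 < (q x ^+ (2 * p))^-1 by rewrite invr_gt0 exprn_gt0.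
(* The limit is built from [q] and [p] before [s] is introduced, so one measure serves all [s]. *)
have [P [k [k0 PE]]] := exists_density (continuous_weight hq0 cq) w0.
exists P; split; last by exists k.
move=> s s0 g cg _.
have mean := mean_le hp hq0 cq k0 PE s0 (fun n n2 => (hD s n s0 n2).1).
rewrite -(fineK (integrable_fin_num _ (integrable_continuous P cg)))//.
under eq_fun do rewrite (integral_empirical _ (measurable_fun_continuous cg)).
apply: cvg_EFin; first exact: nearW.
apply/cvgrPdist_le => e e0.
(* The bound of [mean_le] for the opposite of [g] is the missing lower bound for [g]. *)
have cNg : continuous (fun x => - g x).
  by move=> x; apply: continuous_comp (cg x) _; exact: oppr_continuous.
have IN : Rintegral P setT (fun x => - g x) = - Rintegral P setT g.
  rewrite -mulN1r -RintegralZl//; last exact: integrable_continuous.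
  by congr Rintegral; apply/funext => x; rewrite mulN1r.
apply: filterS2 (mean _ _ cg e0) (mean _ _ cNg e0) => n h1.
rewrite IN sumrN mulNr => h2.
rewrite /= ler_distl; apply/andP; split; first by rewrite lerBlDr.
by rewrite -/(Rintegral P setT g); lra.
Qed.
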